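(* For $n\ge0$ put $$q_n=(4n+1)\frac{\binom{2n}{n}^6}{2^{12n}},\qquad A_n=4H_{2n}-3H_n-2\log2+\frac1{4n+1},$$ $$R_n=4H_{2n}^{(2)}-H_n^{(2)}+\frac{2}{(4n+1)^2},\qquad X_n=A_n^2-\tfrac12R_n,$$ $$U_{3,n}=8H_{2n}^{(3)}-\zeta(3),\qquad U_{4,n}=16H_{2n}^{(4)}-2H_n^{(4)}+\zeta(4),$$ $$U_{5,n}=32H_{2n}^{(5)}-2H_n^{(5)}+\zeta(5),\qquad U_{7,n}=128H_{2n}^{(7)}-\zeta(7).$$ Then $$\sum_{n=0}^\infty q_nU_{3,n}=0,$$ $$\sum_{n=0}^\infty q_n\bigl(A_nU_{4,n}-U_{5,n}\bigr)=0,$$ $$\sum_{n=0}^\infty q_n\bigl(X_nU_{4,n}-2A_nU_{5,n}+U_{3,n}^2\bigr)=0,$$ $$\sum_{n=0}^\infty q_n\bigl(U_{3,n}U_{4,n}-U_{7,n}\bigr)=0.$$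
   Context: $H_n^{(r)}=\sum_{k=1}^n k^{-r}$ are the generalized harmonic numbers, with $H_n=H_n^{(1)}$ and $H_0^{(r)}=0$; $\zeta$ is the Riemann zeta function; $\log$ is the natural logarithm. *)

(* Defs.v *)
From Stdlib Require Import Reals.
From Coquelicot Require Import Coquelicot.
Open Scope R_scope.

Definition harm (r n : nat) : R := sum_n_m (fun k => / INR k ^ r) 1 n.

(* Riemann zeta at integers s >= 2, where its Dirichlet series converges;
   the value at s = 0, 1 is meaningless. *)
Definition zeta (s : nat) : R := Series (fun k => / INR (S k) ^ s).

(* [Binomial.C] is qualified because Coquelicot uses [C] for the complex
   numbers. *)
Definition q (n : nat) : R :=
  (4 * INR n + 1) * (Binomial.C (2 * n) n ^ 6 / 2 ^ (12 * n)).

Definition A (n : nat) : R :=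
  4 * harm 1 (2 * n) - 3 * harm 1 n - 2 * ln 2 + 1 / (4 * INR n + 1).

Definition Rn (n : nat) : R :=
  4 * harm 2 (2 * n) - harm 2 n + 2 / (4 * INR n + 1) ^ 2.

Definition X (n : nat) : R := A n ^ 2 - 1 / 2 * Rn n.

Definition U3 (n : nat) : R := 8 * harm 3 (2 * n) - zeta 3.

Definition U4 (n : nat) : R := 16 * harm 4 (2 * n) - 2 * harm 4 n + zeta 4.

Definition U5 (n : nat) : R := 32 * harm 5 (2 * n) - 2 * harm 5 n + zeta 5.

Definition U7 (n : nat) : R := 128 * harm 7 (2 * n) - zeta 7.

(* Main.v *)
(* For y1, ..., y4 near 0 put a = (1 - y1 - y2 - y3 - y4) / 2 and consider the
   very-well-poised sum over n of
     (a + 2n) (a)_n^2 / n!^2 prod_i (a + y_i)_n / (1 - y_i)_n,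
   terminated at N by one further pair of parameters. Bailey's transformation
   shows that, times prod_i (1 - y_i)_N and a factor depending on a and N only,
   it is even in each y_i. At y = 0 the summand is q_n times a factor rho that
   tends to 1 as N grows, and in terms of the elementary symmetric functions e_k
   of the y_i the Taylor coefficients of e3, e1 e4 and e3 e4 are, for finite N,
   the first, second and fourth summands of the theorem; having odd degree, they
   sum to zero. On the slice p2 = 0 evenness forces the degree 6 part to be a
   multiple of p6, which gives the third summand. Since these are exact
   identities for every N, dominated convergence finishes the proof. *)

Require Import Defs.
From Stdlib Require Import Reals Lra Lia.
From Coquelicot Require Import Coquelicot.
Open Scope R_scope.

Local Open Scope C_scope.

(** The terminating pair is -N, N+1. Its sum is 1 for every N, so the balancing condition of the 9F8
    series reads a + b = 1 - f1, where b = a + y4 and f1 is the sum of the other y_i. This is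
    exactly how a is chosen, and exchanging a with b changes the sign of y4. Taylor coefficients are
    taken for finite N along curves in one real variable t, with bounded remainders in place of
    derivatives. The curves leave the wanted monomial alone in its power of t: e1 = e2 = 0 for e3
    and e3 e4, and e1 of order 3 with e4 of order 4 for e1 e4. Changing all signs takes four single
    flips, each at a known root, hence curves with explicit roots. In degree 6 parity gives nothing;
    there a single root is flipped and the two expansions are compared. The obstacle to the limit is
    that [rho] is not bounded: near n = N it grows like sqrt n, and the first-order coefficient in
    e1 contributes logarithms. The decay of q_n like n^-2 has to absorb both. *)

Definition nC (n : nat) : C := RtoC (INR n).

Lemma nC_S (n : nat) : nC (S n) = nC n + 1.
Proof. unfold nC. now rewrite S_INR, RtoC_plus. Qed.

Lemma nC_add (m n : nat) : nC (m + n) = nC m + nC n.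
Proof. unfold nC. now rewrite plus_INR, RtoC_plus. Qed.

Lemma nC_0 : nC 0 = 0.
Proof. reflexivity. Qed.

Lemma nC_S_neq0 (n : nat) : nC (S n) <> 0.
Proof. unfold nC. intros H. apply RtoC_inj in H. now apply (not_0_INR (S n)). Qed.

Lemma Cmult_cancel_l (c x y : C) : c <> 0 -> c * x = c * y -> x = y.
Proof.
  intros Hc H. replace x with (c * x / c) by (field; exact Hc).
  rewrite H. field. exact Hc.
Qed.

(** * Finite sums, products and Pochhammer symbols over the complex numbers *)

Fixpoint csum (f : nat -> C) (n : nat) : C :=
  match n with O => 0 | S m => csum f m + f m end.

Fixpoint cprod (f : nat -> C) (n : nat) : C :=
  match n with O => 1 | S m => cprod f m * f m end.

Lemma csum_ext (f g : nat -> C) (n : nat) :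
  (forall k, (k < n)%nat -> f k = g k) -> csum f n = csum g n.
Proof.
  induction n as [|n IH]; intros H; simpl; [reflexivity|].
  rewrite IH, H by auto with arith. reflexivity.
Qed.

Lemma csum_scal (c : C) (f : nat -> C) (n : nat) :
  csum (fun k => c * f k) n = c * csum f n.
Proof. induction n as [|n IH]; simpl; [ring|rewrite IH; ring]. Qed.

Lemma csum_plus (f g : nat -> C) (n : nat) :
  csum (fun k => f k + g k) n = csum f n + csum g n.
Proof. induction n as [|n IH]; simpl; [ring|rewrite IH; ring]. Qed.

Lemma csum_minus (f g : nat -> C) (n : nat) :
  csum (fun k => f k - g k) n = csum f n - csum g n.
Proof. induction n as [|n IH]; simpl; [ring|rewrite IH; ring]. Qed.

Lemma csum_telescope (g : nat -> C) (n : nat) :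
  csum (fun k => g (S k) - g k) n = g n - g O.
Proof. induction n as [|n IH]; simpl; [ring|rewrite IH; ring]. Qed.

Lemma csum_triangle (f : nat -> nat -> C) (N : nat) :
  csum (fun n => csum (fun k => f n k) (S n)) N =
  csum (fun k => csum (fun m => f (k + m)%nat k) (N - k)) N.
Proof.
  induction N as [|N IH]; [reflexivity|].
  assert (HS : forall g n, csum g (S n) = csum g n + g n) by reflexivity.
  rewrite (HS _ N), IH, (HS (fun k => csum _ (S N - k)) N), (HS _ N).
  rewrite (csum_ext (fun k => csum (fun m => f (k + m)%nat k) (S N - k))
             (fun k => csum (fun m => f (k + m)%nat k) (N - k) + f N k)).
  - rewrite csum_plus. replace (S N - N)%nat with 1%nat by lia.
    rewrite (HS _ O), Nat.add_0_r. simpl. change (fun k => f N k) with (f N). ring.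
  - intros k Hk. replace (S N - k)%nat with (S (N - k)) by lia.
    rewrite HS. replace (k + (N - k))%nat with N by lia. reflexivity.
Qed.

Lemma cprod_ext (f g : nat -> C) (n : nat) :
  (forall k, (k < n)%nat -> f k = g k) -> cprod f n = cprod g n.
Proof.
  induction n as [|n IH]; intros H; simpl; [reflexivity|].
  rewrite IH, H by auto with arith. reflexivity.
Qed.

Lemma cprod_mult (f g : nat -> C) (n : nat) :
  cprod (fun k => f k * g k) n = cprod f n * cprod g n.
Proof. induction n as [|n IH]; simpl; [ring|rewrite IH; ring]. Qed.

Lemma cprod_add (f : nat -> C) (m n : nat) :
  cprod f (m + n) = cprod f m * cprod (fun j => f (m + j)%nat) n.
Proof.
  induction n as [|n IH]; simpl; [rewrite Nat.add_0_r; ring|].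
  rewrite Nat.add_succ_r. simpl. rewrite IH. ring.
Qed.

Lemma cprod_neq0 (f : nat -> C) (n : nat) :
  (forall k, (k < n)%nat -> f k <> 0) -> cprod f n <> 0.
Proof.
  induction n as [|n IH]; intros H; simpl.
  - apply C1_nz.
  - apply Cmult_neq_0; auto with arith.
Qed.

Lemma cprod_div (f g : nat -> C) (n : nat) :
  (forall k, (k < n)%nat -> g k <> 0) ->
  cprod (fun k => f k / g k) n = cprod f n / cprod g n.
Proof.
  intros H. induction n as [|n IH]; simpl; [field; apply C1_nz|].
  rewrite IH by auto with arith. field. split.
  - apply H; lia.
  - apply cprod_neq0; auto with arith.
Qed.

Definition poch (x : C) (n : nat) : C := cprod (fun j => x + nC j) n.

Lemma poch_S (x : C) (n : nat) : poch x (S n) = poch x n * (x + nC n).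
Proof. reflexivity. Qed.

Lemma poch_add (x : C) (m n : nat) : poch x (m + n) = poch x m * poch (x + nC m) n.
Proof.
  unfold poch. rewrite cprod_add. f_equal. apply cprod_ext. intros k _.
  rewrite nC_add. ring.
Qed.

Lemma poch_neq0 (x : C) (n : nat) : (forall j, x + nC j <> 0) -> poch x n <> 0.
Proof. intros H. apply cprod_neq0; auto. Qed.

(** * Dougall's summation *)

Definition cubic (f1 f2 f3 x : C) : C := x ^ 3 + f1 * x ^ 2 + f2 * x + f3.

(** If f1, f2, f3 are the elementary symmetric functions of y1, y2, y3, this is (x)_n prod_i (x +
    y_i)_n / (n! prod_i (1 - y_i)_n): negating f1 and f3 turns prod_i (x + y_i) into prod_i (x -
    y_i). *)
Definition cubic_ratio (f1 f2 f3 x : C) (n : nat) : C :=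
  cprod (fun j => (x + nC j) * cubic f1 f2 f3 (x + nC j) /
                  (nC (S j) * cubic (- f1) f2 (- f3) (nC (S j)))) n.

Definition poch_fact (x : C) (n : nat) : C := cprod (fun j => (x + nC j) / nC (S j)) n.

(* Dougall's 2-balanced terminating 7F6 summation. Three of its parameters enter
   only through their elementary symmetric functions, encoded by the cubic, so no
   roots are needed. The right-hand side satisfies the first-order recurrence in
   [n] of the left-hand side by the WZ certificate [G]. *)
Lemma dougall (a b f1 f2 f3 : C) (n : nat) :
  a + b = 1 - f1 ->
  (forall j, b + nC j <> 0) ->
  (forall j, cubic (- f1) f2 (- f3) (nC (S j)) <> 0) ->
  cubic_ratio f1 f2 f3 a n =
  csum (fun k => poch_fact (a - b) (n - k) * (poch a (n + k) / poch b (S (n + k))) *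
                 (b + 2 * nC k) * cubic_ratio f1 f2 f3 b k) (S n).
Proof.
  intros Hab Hb HQ.
  assert (Hf : f1 = 1 - a - b).
  { transitivity (1 - (1 - f1)); [ring|]. rewrite <- Hab. ring. }
  clear Hab.
  set (V := cubic_ratio f1 f2 f3) in *. set (p := cubic f1 f2 f3) in *.
  set (Q := cubic (- f1) f2 (- f3)) in *.
  set (L := poch_fact (a - b)).
  set (M := fun s => poch a s / poch b (S s)).
  assert (HL : forall m, L (S m) = L m * ((a - b + nC m) / nC (S m))) by reflexivity.
  assert (HM : forall m, M (S m) = M m * ((a + nC m) / (b + nC (S m)))).
  { intros m. unfold M. rewrite (poch_S b (S m)), (poch_S a m).
    field. repeat split; try apply Hb. now apply poch_neq0. }
  assert (HV : forall x m, V x (S m) =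
    V x m * ((x + nC m) * p (x + nC m) / (nC (S m) * Q (nC (S m))))) by reflexivity.
  change (V a n = csum (fun k => L (n - k)%nat * M (n + k)%nat * (b + 2 * nC k) * V b k) (S n)).
  induction n as [|n IH].
  { simpl. unfold V, L, M, cubic_ratio, poch_fact, poch. simpl.
    assert (H0 := Hb O). rewrite nC_0, Cplus_0_r in *. field. assumption. }
  rewrite HV, IH.
  set (s := fun n k => L (n - k)%nat * M (n + k)%nat * (b + 2 * nC k) * V b k).
  change (csum (s n) (S n) * ((a + nC n) * p (a + nC n) / (nC (S n) * Q (nC (S n)))) =
          csum (s (S n)) (S n) + s (S n) (S n)).
  assert (Hn := nC_S_neq0 n). assert (HQn := HQ n).
  set (G := fun k => - (a + 2 * nC n + 1) * L (S n - k)%nat * M (n + k)%nat *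
                     (nC k * Q (nC k)) * V b k).
  (* The telescoping stops at k = n, since truncated subtraction would give [s n (S n)] a spurious
     value. The term k = n + 1, which occurs only in the sum for n + 1, cancels the boundary value
     [G (S n)] by [HGn]. *)
  assert (HD : csum (fun k => nC (S n) * Q (nC (S n)) * s (S n) k -
                              (a + nC n) * p (a + nC n) * s n k) (S n) = G (S n) - G O).
  { rewrite <- csum_telescope. apply csum_ext. intros k Hk.
    unfold G, s.
    destruct (Nat.le_exists_sub k n ltac:(lia)) as [l [-> _]].
    replace (S (l + k) - k)%nat with (S l) by lia.
    replace (l + k - k)%nat with l by lia.
    replace (S (l + k) - S k)%nat with l by lia.
    replace (S (l + k) + k)%nat with (S (l + k + k)) by lia.
    replace (l + k + S k)%nat with (S (l + k + k)) by lia.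
    rewrite HM, HL, HV.
    assert (H1 := nC_S_neq0 l). assert (H2 := Hb (S (l + k + k))).
    assert (H3 := nC_S_neq0 k). assert (H4 := HQ k).
    unfold p, Q, cubic in *. rewrite Hf in *. rewrite !nC_S, !nC_add in *.
    field. repeat split; assumption. }
  assert (HG0 : G O = 0) by (unfold G; rewrite nC_0; ring).
  assert (HGn : nC (S n) * Q (nC (S n)) * s (S n) (S n) = - G (S n)).
  { unfold G, s. replace (S n + S n)%nat with (S (n + S n)) by lia.
    replace (S n - S n)%nat with O by lia. rewrite HM.
    assert (H2 := Hb (S (n + S n))). rewrite !nC_S, !nC_add, !nC_S in *. field. assumption. }
  assert (HE : csum (fun k => nC (S n) * Q (nC (S n)) * s (S n) k -
                              (a + nC n) * p (a + nC n) * s n k) (S n) =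
     nC (S n) * Q (nC (S n)) * csum (s (S n)) (S n) -
     (a + nC n) * p (a + nC n) * csum (s n) (S n)).
  { rewrite csum_minus, 2!csum_scal. reflexivity. }
  rewrite HD, HG0 in HE.
  apply (Cmult_cancel_l (nC (S n) * Q (nC (S n)))); [now apply Cmult_neq_0|].
  rewrite (Cmult_plus_distr_l _ (csum (s (S n)) (S n))), HGn.
  replace (G (S n)) with (nC (S n) * Q (nC (S n)) * csum (s (S n)) (S n) -
     (a + nC n) * p (a + nC n) * csum (s n) (S n)) by (rewrite <- HE; ring).
  field. split; assumption.
Qed.

(** * Bailey's transformation *)

Lemma poch_fact_eq (x : C) (n : nat) : poch_fact x n = poch x n / poch 1 n.
Proof.
  unfold poch_fact, poch.
  rewrite cprod_div by (intros; apply nC_S_neq0).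
  rewrite (cprod_ext (fun j => nC (S j)) (fun j => 1 + nC j)); [reflexivity|].
  intros k _. rewrite nC_S. ring.
Qed.

Lemma poch1_neq0 (n : nat) : poch 1 n <> 0.
Proof.
  apply poch_neq0. intros j. replace (1 + nC j) with (nC (S j)) by (rewrite nC_S; ring).
  apply nC_S_neq0.
Qed.

Lemma poch_shift_neq0 (x : C) (k n : nat) :
  (forall j, x + nC j <> 0) -> poch (x + nC k) n <> 0.
Proof.
  intros H. apply poch_neq0. intros j.
  replace (x + nC k + nC j) with (x + nC (k + j)) by (rewrite nC_add; ring). apply H.
Qed.

(** Up to a factor free of n, the last line is (-N)_n (N+1)_n / ((a-N)_n (a+N+1)_n), the well-poised
    pair -N, N+1. In the form given here it is also the kernel of [dougall] with 1 and a in place of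
    a and b, which is what makes the inner sum below summable. *)
Definition bailey_weight (N : nat) (a b : C) (n : nat) : C :=
  poch a n * poch b n / (poch 1 n * poch (1 + a - b) n) *
  (poch_fact (1 - a) (N - n) * (poch 1 (N + n) / poch a (S (N + n)))).

(** This is [dougall] read from right to left, of length N - k, with 1 + 2k and a + 2k in place of a
    and b. The three parameters of the cubic are -k, b - a - k and -b - 2k; their sum -a - 4k meets
    the balancing condition. *)
Lemma bailey_inner (N k : nat) (a b : C) :
  (k <= N)%nat ->
  (forall j, a + nC j <> 0) -> (forall j, b + nC j <> 0) ->
  (forall j, 1 + a - b + nC j <> 0) -> (forall j, 1 + b - a + nC j <> 0) ->
  csum (fun m => (a + 2 * nC (k + m)) * bailey_weight N a b (k + m) *
          (poch_fact (a - b) m * (poch a (k + m + k) / poch b (S (k + m + k)))))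
       (S N - k) =
  bailey_weight N b a k * (poch (1 + b - a) N / poch (1 + a - b) N).
Proof.
  intros HkN Ha Hb Hab Hba.
  destruct (Nat.le_exists_sub k N HkN) as [r [-> _]].
  replace (S (r + k) - k)%nat with (S r) by lia.
  set (K := poch a k * poch b k / (poch 1 k * poch (1 + a - b) k) *
            (poch 1 (k + k) / poch b (S (k + k)))).
  set (x := nC k).
  set (f2 := (- x) * (b - a - x) + (- x) * (- b - 2 * x) + (b - a - x) * (- b - 2 * x)).
  set (f3 := x * (b - a - x) * (b + 2 * x)).
  assert (Hcub : forall u, cubic (- a - 4 * x) f2 f3 u =
    (u - x) * (u + b - a - x) * (u - b - 2 * x))
    by (intros u; unfold cubic, f2, f3; ring).
  assert (HcubN : forall u, cubic (- (- a - 4 * x)) f2 (- f3) u =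
                    (u + x) * (u + a - b + x) * (u + b + 2 * x))
    by (intros u; unfold cubic, f2, f3; ring).
  assert (E1 : forall j, nC (S j) + x = 1 + x + nC j) by (intros; rewrite nC_S; ring).
  assert (E2 : forall j, nC (S j) + a - b + x = 1 + a - b + x + nC j)
    by (intros; rewrite nC_S; ring).
  assert (E3 : forall j, nC (S j) + b + 2 * x = b + nC (S (k + k)) + nC j)
    by (intros; rewrite !nC_S, nC_add; fold x; ring).
  assert (H1 : forall j, 1 + nC j <> 0).
  { intros j. replace (1 + nC j) with (nC (S j)) by (rewrite nC_S; ring). apply nC_S_neq0. }
  assert (N1 : forall n, poch (1 + x) n <> 0) by (intros; now apply poch_shift_neq0).
  assert (N2 : forall n, poch (1 + a - b + x) n <> 0) by (intros; now apply poch_shift_neq0).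
  assert (N2' : forall n, poch (1 + b - a + x) n <> 0) by (intros; now apply poch_shift_neq0).
  assert (N3 : forall n, poch (b + nC (S (k + k))) n <> 0) by (intros; now apply poch_shift_neq0).
  assert (N4 : forall n, poch (a + 2 * x) n <> 0).
  { intros n. replace (a + 2 * x) with (a + nC (k + k)) by (rewrite nC_add; fold x; ring).
    now apply poch_shift_neq0. }
  assert (HV : forall u n, cubic_ratio (- a - 4 * x) f2 f3 u n =
     poch u n * (poch (u - x) n * poch (u + b - a - x) n * poch (u - b - 2 * x) n) /
     (poch 1 n * (poch (1 + x) n * poch (1 + a - b + x) n * poch (b + nC (S (k + k))) n))).
  { intros u n. unfold poch. rewrite <- !cprod_mult.
    rewrite <- cprod_div.
    - apply cprod_ext. intros j _. rewrite Hcub, HcubN, E1, E2, E3.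
      f_equal; [f_equal; ring|]. rewrite nC_S. f_equal. ring.
    - intros j _. repeat apply Cmult_neq_0.
      + apply H1.
      + rewrite <- E1, nC_S. unfold x. replace (nC j + 1 + nC k) with (1 + nC (j + k)).
        apply H1. rewrite nC_add; ring.
      + unfold x. replace (1 + a - b + nC k + nC j) with (1 + a - b + nC (k + j)).
        apply Hab. rewrite nC_add; ring.
      + replace (b + nC (S (k + k)) + nC j) with (b + nC (S (k + k) + j)).
        apply Hb. rewrite nC_add; ring. }
  assert (P1 := poch1_neq0).
  transitivity (K * cubic_ratio (- a - 4 * x) f2 f3 (1 + 2 * x) r).
  - rewrite (dougall (1 + 2 * x) (a + 2 * x)).
    + rewrite <- csum_scal. apply csum_ext. intros m Hm.
      rewrite HV. unfold K, bailey_weight.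
      replace (r + k - (k + m))%nat with (r - m)%nat by lia.
      replace (1 + 2 * x - (a + 2 * x)) with (1 - a) by ring.
      replace (k + m + k)%nat with (k + k + m)%nat by lia.
      replace (r + k + (k + m))%nat with (k + k + (r + m))%nat by lia.
      replace (S (k + k + m)) with (S (k + k) + m)%nat by lia.
      replace (S (k + k + (r + m))) with (k + k + S (r + m))%nat by lia.
      rewrite (poch_fact_eq (a - b)), (poch_add a k m), (poch_add b k m), (poch_add 1 k m),
        (poch_add (1 + a - b) k m), (poch_add 1 (k + k)), (poch_add a (k + k) m),
        (poch_add a (k + k) (S _)), (poch_add b (S (k + k))).
      replace (nC (k + k)) with (2 * x) by (rewrite nC_add; fold x; ring).
      rewrite nC_add. fold x.
      replace (a + 2 * x - x) with (a + x) by ring.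
      replace (a + 2 * x + b - a - x) with (b + x) by ring.
      replace (a + 2 * x - b - 2 * x) with (a - b) by ring.
      replace (a + 2 * x + 2 * nC m) with (a + 2 * (x + nC m)) by ring.
      field. repeat split; auto using poch_neq0.
    + ring.
    + intros j. replace (a + 2 * x + nC j) with (a + nC (k + k + j)).
      apply Ha. rewrite !nC_add. fold x. ring.
    + intros j. rewrite HcubN, E1, E2, E3. repeat apply Cmult_neq_0.
      * unfold x. replace (1 + nC k + nC j) with (1 + nC (k + j)). apply H1. rewrite nC_add; ring.
      * unfold x. replace (1 + a - b + nC k + nC j) with (1 + a - b + nC (k + j)).
        apply Hab. rewrite nC_add; ring.
      * replace (b + nC (S (k + k)) + nC j) with (b + nC (S (k + k) + j)).
        apply Hb. rewrite nC_add; ring.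
  - rewrite HV. unfold K, bailey_weight.
    replace (r + k - k)%nat with r by lia.
    replace (r + k + k)%nat with (k + k + r)%nat by lia.
    replace (S (k + k + r)) with (S (k + k) + r)%nat by lia.
    replace (r + k)%nat with (k + r)%nat by lia.
    rewrite poch_fact_eq, (poch_add 1 (k + k) r), (poch_add b (S (k + k)) r),
      (poch_add (1 + a - b) k r), (poch_add (1 + b - a) k r).
    replace (nC (k + k)) with (2 * x) by (rewrite nC_add; fold x; ring).
    fold x.
    replace (1 + 2 * x - x) with (1 + x) by ring.
    replace (1 + 2 * x + b - a - x) with (1 + b - a + x) by ring.
    replace (1 + 2 * x - b - 2 * x) with (1 - b) by ring.
    field. repeat split; auto using poch_neq0.
Qed.

Definition bailey_sum (N : nat) (f1 f2 f3 a b : C) : C :=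
  csum (fun n => (a + 2 * nC n) * bailey_weight N a b n * cubic_ratio f1 f2 f3 a n) (S N).

(* Bailey's transformation of terminating very-well-poised 9F8 series: expand
   [cubic_ratio] at [a] by Dougall's sum, exchange the two sums, and evaluate
   the inner one by Dougall's sum again. *)
Lemma bailey_sum_symmetric (N : nat) (f1 f2 f3 a b : C) :
  a + b = 1 - f1 ->
  (forall j, a + nC j <> 0) -> (forall j, b + nC j <> 0) ->
  (forall j, 1 + a - b + nC j <> 0) -> (forall j, 1 + b - a + nC j <> 0) ->
  (forall j, cubic (- f1) f2 (- f3) (nC (S j)) <> 0) ->
  poch (1 + a - b) N * bailey_sum N f1 f2 f3 a b =
  poch (1 + b - a) N * bailey_sum N f1 f2 f3 b a.
Proof.
  intros Hf Ha Hb Hab Hba HQ.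
  set (T := fun n k => (a + 2 * nC n) * bailey_weight N a b n *
     (poch_fact (a - b) (n - k) * (poch a (n + k) / poch b (S (n + k))) *
                 (b + 2 * nC k) * cubic_ratio f1 f2 f3 b k)).
  assert (E : bailey_sum N f1 f2 f3 a b = csum (fun n => csum (fun k => T n k) (S n)) (S N)).
  { unfold bailey_sum. apply csum_ext. intros n _.
    rewrite (dougall a b) by assumption. now rewrite <- csum_scal. }
  rewrite E, csum_triangle. unfold bailey_sum. rewrite <- !csum_scal.
  apply csum_ext. intros k Hk.
  assert (I := bailey_inner N k a b ltac:(lia) Ha Hb Hab Hba).
  transitivity (poch (1 + a - b) N * ((b + 2 * nC k) * cubic_ratio f1 f2 f3 b k *
     (bailey_weight N b a k * (poch (1 + b - a) N / poch (1 + a - b) N)))).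
  - rewrite <- I, <- (csum_scal ((b + 2 * nC k) * _)). f_equal.
    apply csum_ext. intros m _. unfold T.
    replace (k + m - k)%nat with m by lia. ring.
  - field. now apply poch_neq0.
Qed.

(** * Evenness of the symmetric sum in each root *)

Definition quartic (e1 e2 e3 e4 x : C) : C := x ^ 4 + e1 * x ^ 3 + e2 * x ^ 2 + e3 * x + e4.

(** Here [quartic] is prod_i (x + y_i), and the last product is prod_i (1 - y_i)_N / (1 - y_i)_n.
    Multiplying the series by prod_i (1 - y_i)_N thus clears the denominators in the y_i and leaves
    a function of e1, ..., e4 alone. *)
Definition omega_term (N : nat) (e1 e2 e3 e4 : C) (n : nat) : C :=
  let a := (1 - e1) / 2 in
  (a + 2 * nC n) * (poch a n ^ 2 / poch 1 n ^ 2) *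
  (poch_fact (1 - a) (N - n) * (poch 1 (N + n) / poch a (S (N + n)))) *
  cprod (fun j => quartic e1 e2 e3 e4 (a + nC j)) n *
  cprod (fun j => quartic (- e1) e2 (- e3) e4 (nC (S (n + j)))) (N - n).

Definition omega (N : nat) (e1 e2 e3 e4 : C) : C :=
  csum (omega_term N e1 e2 e3 e4) (S N).

(** The root s enters through b = a + s and 1 + a - b = 1 - s. The prefactor (1 + a - b)_N of
    Bailey's symmetry is therefore the factor (1 - s)_N that [omega] requires, and the cubic
    supplies the other three. *)
Lemma bailey_sum_omega (N : nat) (s f1 f2 f3 : C) :
  let a := (1 - s - f1) / 2 in
  let b := (1 + s - f1) / 2 in
  (forall j, a + nC j <> 0) -> (forall j, 1 + a - b + nC j <> 0) ->
  (forall j, cubic (- f1) f2 (- f3) (nC (S j)) <> 0) ->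
  cprod (fun j => cubic (- f1) f2 (- f3) (nC (S j))) N *
    (poch (1 + a - b) N * bailey_sum N f1 f2 f3 a b) =
  omega N (s + f1) (f2 + s * f1) (f3 + s * f2) (s * f3).
Proof.
  intros a b Ha Hab HQ. unfold bailey_sum, omega. rewrite <- !csum_scal.
  apply csum_ext. intros n Hn. unfold omega_term, bailey_weight, cubic_ratio.
  destruct (Nat.le_exists_sub n N ltac:(lia)) as [r [-> _]].
  replace (r + n - n)%nat with r by lia.
  replace (r + n + n)%nat with (n + n + r)%nat by lia.
  replace (r + n)%nat with (n + r)%nat by lia.
  replace ((1 - (s + f1)) / 2) with a by (unfold a; f_equal; ring).
  assert (Hb : b = a + s) by (unfold a, b; field).
  rewrite (cprod_ext (fun j => quartic (s + f1) (f2 + s * f1) (f3 + s * f2) (s * f3) (a + nC j))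
    (fun j => (b + nC j) * cubic f1 f2 f3 (a + nC j)))
    by (intros j _; rewrite Hb; unfold quartic, cubic; ring).
  rewrite (cprod_ext (fun j => quartic (- (s + f1)) (f2 + s * f1) (- (f3 + s * f2)) (s * f3)
       (nC (S (n + j))))
    (fun j => (1 + a - b + nC n + nC j) * cubic (- f1) f2 (- f3) (nC (S (n + j)))))
    by (intros j _; rewrite Hb, !nC_S, !nC_add; unfold quartic, cubic; ring).
  rewrite cprod_div, !cprod_mult, cprod_add, poch_add.
  2: { intros j _. apply Cmult_neq_0; [apply nC_S_neq0|apply HQ]. }
  rewrite (cprod_ext (fun j => nC (S j)) (fun j => 1 + nC j))
    by (intros j _; rewrite nC_S; ring).
  fold (poch 1 n) (poch a n) (poch b n) (poch (1 + a - b + nC n) r).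
  field. repeat split; auto using poch_neq0, poch1_neq0, cprod_neq0.
Qed.

(* The three roots that are not flipped need not be known: only their cubic enters. *)
Lemma omega_flip (N : nat) (s f1 f2 f3 : C) :
  (forall j, (1 - s - f1) / 2 + nC j <> 0) -> (forall j, (1 + s - f1) / 2 + nC j <> 0) ->
  (forall j, nC (S j) - s <> 0) -> (forall j, nC (S j) + s <> 0) ->
  (forall j, cubic (- f1) f2 (- f3) (nC (S j)) <> 0) ->
  omega N (s + f1) (f2 + s * f1) (f3 + s * f2) (s * f3) =
  omega N (- s + f1) (f2 - s * f1) (f3 - s * f2) (- s * f3).
Proof.
  intros Ha Hb Hs Hs' HQ.
  set (a := (1 - s - f1) / 2) in *. set (b := (1 + s - f1) / 2) in *.
  assert (Hab : forall j, 1 + a - b + nC j <> 0).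
  { intros j. replace (1 + a - b + nC j) with (nC (S j) - s); [apply Hs|].
    rewrite nC_S; unfold a, b; field. }
  assert (Hba : forall j, 1 + b - a + nC j <> 0).
  { intros j. replace (1 + b - a + nC j) with (nC (S j) + s); [apply Hs'|].
    rewrite nC_S; unfold a, b; field. }
  rewrite <- (bailey_sum_omega N s f1 f2 f3) by assumption.
  fold a b.
  rewrite (bailey_sum_symmetric N f1 f2 f3 a b); try assumption.
  2: { unfold a, b; field. }
  assert (E : b = (1 - - s - f1) / 2) by (unfold b; f_equal; ring).
  assert (E' : a = (1 + - s - f1) / 2) by (unfold a; f_equal; ring).
  replace (f2 - s * f1) with (f2 + - s * f1) by ring.
  replace (f3 - s * f2) with (f3 + - s * f2) by ring.
  rewrite <- (bailey_sum_omega N (- s) f1 f2 f3); rewrite <- ?E, <- ?E'; auto.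
Qed.

Lemma neq0_of_Re_pos (z : C) : (0 < Re z)%R -> z <> 0.
Proof. intros H E. rewrite E in H. simpl in H. lra. Qed.

Lemma Re_plus (x y : C) : Re (x + y) = (Re x + Re y)%R.
Proof. reflexivity. Qed.

Lemma Re_opp (x : C) : Re (- x) = (- Re x)%R.
Proof. reflexivity. Qed.

Lemma Re_half (x : C) : Re (x / 2) = (Re x / 2)%R.
Proof. unfold Cdiv, Cinv, Re. simpl. field. Qed.

Lemma Re_nC (n : nat) : Re (nC n) = INR n.
Proof. reflexivity. Qed.

Definition omega_roots (N : nat) (y1 y2 y3 y4 : C) : C :=
  omega N (y1 + y2 + y3 + y4)
    (y1 * y2 + y1 * y3 + y1 * y4 + y2 * y3 + y2 * y4 + y3 * y4)
    (y1 * y2 * y3 + y1 * y2 * y4 + y1 * y3 * y4 + y2 * y3 * y4)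
    (y1 * y2 * y3 * y4).

(** With real parts below 1/4, the real part of e1 stays below 1 in modulus under any change of
    signs. So a and b have positive real part, and no y_i meets a nonzero integer. *)
Lemma omega_roots_flip (N : nat) (y1 y2 y3 y4 : C) :
  (Rabs (Re y1) < 1 / 4 -> Rabs (Re y2) < 1 / 4 ->
   Rabs (Re y3) < 1 / 4 -> Rabs (Re y4) < 1 / 4 ->
  omega_roots N y1 y2 y3 y4 = omega_roots N (- y1) y2 y3 y4)%R.
Proof.
  intros H1 H2 H3 H4.
  apply Rabs_def2 in H1, H2, H3, H4.
  assert (F := omega_flip N y1 (y2 + y3 + y4) (y2 * y3 + y2 * y4 + y3 * y4) (y2 * y3 * y4)).
  unfold omega_roots.
  replace (y1 + y2 + y3 + y4) with (y1 + (y2 + y3 + y4)) by ring.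
  replace (- y1 + y2 + y3 + y4) with (- y1 + (y2 + y3 + y4)) by ring.
  match type of F with _ -> _ -> _ -> _ -> _ -> omega _ _ ?u ?v ?w = omega _ _ ?u' ?v' ?w' =>
    match goal with |- omega _ _ ?x ?y ?z = omega _ _ ?x' ?y' ?z' =>
      replace x with u by ring; replace y with v by ring; replace z with w by ring;
      replace x' with u' by ring; replace y' with v' by ring; replace z' with w' by ring
    end end.
  assert (HQ : forall j, cubic (- (y2 + y3 + y4)) (y2 * y3 + y2 * y4 + y3 * y4)
                           (- (y2 * y3 * y4)) (nC (S j)) <> 0).
  { intros j. replace (cubic _ _ _ _) with ((nC (S j) - y2) * (nC (S j) - y3) * (nC (S j) - y4))
      by (unfold cubic; ring).
    assert (Hj := pos_INR j).
    repeat apply Cmult_neq_0; apply neq0_of_Re_pos;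
      unfold Cminus; rewrite ?Re_plus, ?Re_opp, ?Re_nC, ?S_INR; lra. }
  apply F; try exact HQ; intros j; assert (Hj := pos_INR j); apply neq0_of_Re_pos;
    unfold Cminus; rewrite ?Re_plus, ?Re_half, ?Re_plus, ?Re_opp, ?Re_plus, ?Re_nC, ?S_INR;
    simpl; lra.
Qed.

Lemma omega_roots_opp (N : nat) (y1 y2 y3 y4 : C) :
  (Rabs (Re y1) < 1 / 4 -> Rabs (Re y2) < 1 / 4 ->
   Rabs (Re y3) < 1 / 4 -> Rabs (Re y4) < 1 / 4 ->
  omega_roots N y1 y2 y3 y4 = omega_roots N (- y1) (- y2) (- y3) (- y4))%R.
Proof.
  intros H1 H2 H3 H4.
  assert (rot : forall x y z w, omega_roots N x y z w = omega_roots N y z w x)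
    by (intros; unfold omega_roots; f_equal; ring).
  assert (neg : forall x, (Rabs (Re x) < 1 / 4 -> Rabs (Re (- x)) < 1 / 4)%R)
    by (intros x; rewrite Re_opp, Rabs_Ropp; auto).
  (* Each round flips the first root and moves it to the end; four rounds restore the order. *)
  do 4 (rewrite omega_roots_flip, rot by auto). reflexivity.
Qed.

(** * Normalization by the value at y = 0 *)

Definition central (m : nat) : R := (Binomial.C (2 * m) m / 4 ^ m)%R.

Lemma central_S (m : nat) : (central (S m) = central m * ((/ 2 + INR m) / INR (S m)))%R.
Proof.
  unfold central, Binomial.C.
  replace (2 * m - m)%nat with m by lia. replace (2 * S m - S m)%nat with (S m) by lia.
  replace (2 * S m)%nat with (S (S (2 * m))) by lia.
  rewrite (fact_simpl (S (2 * m))), (fact_simpl (2 * m)), (fact_simpl m).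
  rewrite !mult_INR, !S_INR, mult_INR.
  assert (H := pos_INR m). assert (H1 := INR_fact_neq_0 m).
  assert (H2 := pow_nonzero 4 m ltac:(lra)).
  simpl. field. repeat split; try assumption; lra.
Qed.

Lemma central_pos (m : nat) : (0 < central m)%R.
Proof.
  induction m as [|m IH].
  - unfold central, Binomial.C. simpl. lra.
  - rewrite central_S. apply Rmult_lt_0_compat; [exact IH|].
    rewrite S_INR. assert (H := pos_INR m). apply Rdiv_lt_0_compat; lra.
Qed.

Lemma q_central (n : nat) : q n = ((4 * INR n + 1) * central n ^ 6)%R.
Proof.
  unfold q, central, Rdiv. rewrite Rpow_mult_distr, pow_inv. do 3 f_equal.
  rewrite <- pow_mult. replace 4%R with (2 ^ 2)%R by (simpl; ring).
  rewrite <- pow_mult. f_equal. lia.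
Qed.

(** The terminating pair at a = 1/2, scaled to be 1 at n = 0; note that [central m] is (1/2)_m /
    m!. *)
Definition rho (N n : nat) : R :=
  ((2 * INR N + 1) * central (N - n) / ((2 * INR N + 2 * INR n + 1) * central (N + n)))%R.

Definition hC (j : nat) : C := / 2 + nC j.

Lemma hC_eq (j : nat) : hC j = RtoC (/ 2 + INR j).
Proof. unfold hC, nC. rewrite RtoC_plus, RtoC_inv. reflexivity. lra. Qed.

Lemma hC_neq0 (j : nat) : hC j <> 0.
Proof.
  rewrite hC_eq. intros H. apply RtoC_inj in H. assert (H1 := pos_INR j). lra.
Qed.

Lemma poch_half (n : nat) : cprod hC n = RtoC (central n) * poch 1 n.
Proof.
  induction n as [|n IH].
  - unfold central, Binomial.C, poch. simpl. unfold Rdiv. 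
    replace (1 * / (1 * 1) * / 1)%R with 1%R by field. ring.
  - rewrite central_S, poch_S. change (cprod hC (S n)) with (cprod hC n * hC n). rewrite IH.
    rewrite RtoC_mult, RtoC_div by (apply not_0_INR; lia). rewrite hC_eq.
    change (RtoC (INR (S n))) with (nC (S n)). rewrite nC_S. 
    field. rewrite <- nC_S. apply nC_S_neq0.
Qed.

(** The quotient of [omega_term] by its value at y = 0, written as a product of factors that are
    each 1 there, so that coefficients of logarithms can be added factor by factor. *)
Definition norm_term (N : nat) (e1 e2 e3 e4 : C) (n : nat) : C :=
  let a := (1 - e1) / 2 in
  (a + 2 * nC n) / (/ 2 + 2 * nC n) *
  cprod (fun j => (a + nC j) / hC j) n ^ 2 *
  cprod (fun j => (1 - a + nC j) / hC j) (N - n) *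
  cprod (fun j => hC j / (a + nC j)) (S (N + n)) *
  cprod (fun j => quartic e1 e2 e3 e4 (a + nC j) / hC j ^ 4) n *
  cprod (fun j => quartic (- e1) e2 (- e3) e4 (nC (S (n + j))) / nC (S (n + j)) ^ 4) (N - n).

Lemma cprod_pow (f : nat -> C) (k n : nat) :
  cprod (fun j => f j ^ k) n = cprod f n ^ k.
Proof.
  induction n as [|n IH]; simpl.
  - now rewrite Cpow_1_l.
  - now rewrite IH, Cpow_mult_l.
Qed.

Lemma omega_term_norm (N n : nat) (e1 e2 e3 e4 : C) :
  (n <= N)%nat ->
  (forall j, (1 - e1) / 2 + nC j <> 0) ->
  omega_term N e1 e2 e3 e4 n =
  poch 1 N ^ 4 / (2 * nC N + 1) * (RtoC (q n * rho N n) * norm_term N e1 e2 e3 e4 n).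
Proof.
  intros HnN Ha. unfold omega_term, norm_term.
  set (a := (1 - e1) / 2) in *.
  destruct (Nat.le_exists_sub n N HnN) as [r [-> _]].
  unfold rho. replace (r + n - n)%nat with r by lia.
  replace (r + n + n)%nat with (n + n + r)%nat by lia.
  rewrite !cprod_div by (intros;
    first [apply hC_neq0 | apply Ha | apply Cpow_nz, hC_neq0 | apply Cpow_nz, nC_S_neq0]).
  rewrite !cprod_pow, poch_fact_eq, q_central.
  fold (poch a n) (poch (1 - a) r) (poch a (S (n + n + r))).
  assert (Hr := RtoC_inj (central r) 0). assert (Hn := RtoC_inj (central n) 0).
  assert (Hs := RtoC_inj (central (n + n + r)) 0).
  assert (Pr := central_pos r). assert (Pn := central_pos n).
  assert (Ps := central_pos (n + n + r)).
  assert (HN : cprod (fun j => nC (S (n + j))) r = poch 1 (r + n) / poch 1 n).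
  { replace (r + n)%nat with (n + r)%nat by lia. rewrite poch_add.
    rewrite (cprod_ext (fun j => nC (S (n + j))) (fun j => 1 + nC n + nC j))
      by (intros j _; rewrite nC_S, nC_add; ring).
    fold (poch (1 + nC n) r). field. apply poch1_neq0. }
  rewrite HN. change (cprod hC (S (n + n + r))) with (cprod hC (n + n + r) * hC (n + n + r)).
  rewrite !poch_half.
  assert (Pos := pos_INR n). assert (Pos' := pos_INR r).
  rewrite !RtoC_mult, RtoC_pow, RtoC_div, !RtoC_mult, !RtoC_plus, !RtoC_mult.
  change (RtoC (INR n)) with (nC n). change (RtoC (INR (r + n))) with (nC (r + n)).
  unfold hC. rewrite !nC_add.
  assert (E1 : 2 * (nC r + nC n) + 1 <> 0).
  { apply neq0_of_Re_pos. simpl. lra. }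
  assert (E2 : 2 * (nC r + nC n) + 2 * nC n + 1 <> 0).
  { apply neq0_of_Re_pos. simpl. lra. }
  assert (E3 : 1 + 2 * nC n * 2 <> 0).
  { apply neq0_of_Re_pos. simpl. lra. }
  1: field; repeat split; try apply poch1_neq0; try assumption; try (now apply poch_neq0);
    try (intros E; match goal with H : _ -> central _ = 0%R |- _ => apply H in E; lra end).
  rewrite plus_INR. apply Rmult_integral_contrapositive_currified; lra.
Qed.

Lemma omega_norm (N : nat) (e1 e2 e3 e4 : C) :
  (forall j, (1 - e1) / 2 + nC j <> 0) ->
  omega N e1 e2 e3 e4 =
  poch 1 N ^ 4 / (2 * nC N + 1) *
  csum (fun n => RtoC (q n * rho N n) * norm_term N e1 e2 e3 e4 n) (S N).
Proof.
  intros Ha. unfold omega. rewrite <- csum_scal. apply csum_ext. intros n Hn.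
  apply omega_term_norm; [lia|exact Ha].
Qed.

Lemma norm_sum_eq_of_omega_eq (N : nat) (e1 e2 e3 e4 e1' e2' e3' e4' : C) :
  (forall j, (1 - e1) / 2 + nC j <> 0) -> (forall j, (1 - e1') / 2 + nC j <> 0) ->
  omega N e1 e2 e3 e4 = omega N e1' e2' e3' e4' ->
  csum (fun n => RtoC (q n * rho N n) * norm_term N e1 e2 e3 e4 n) (S N) =
  csum (fun n => RtoC (q n * rho N n) * norm_term N e1' e2' e3' e4' n) (S N).
Proof.
  intros Ha Ha'. rewrite !omega_norm by assumption. apply Cmult_cancel_l.
  assert (E : 2 * nC N + 1 <> 0).
  { apply neq0_of_Re_pos. assert (H := pos_INR N). simpl. lra. }
  apply Cmult_neq_0; [apply Cpow_nz, poch1_neq0|].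
  intros H. apply C1_nz. rewrite <- (Cinv_r _ E), H. ring.
Qed.

(** * Truncated expansions with bounded remainder *)

Definition bounded_near0 (f : R -> C) : Prop :=
  exists M : R, forall t : R, (Rabs t <= 1 / 100)%R -> (Cmod (f t) <= M)%R.

Lemma bounded_const (c : C) : bounded_near0 (fun _ => c).
Proof. exists (Cmod c). intros; lra. Qed.

Lemma bounded_id : bounded_near0 (fun t => RtoC t).
Proof. exists (1 / 100)%R. intros t Ht. now rewrite Cmod_R. Qed.

Lemma bounded_plus (f g : R -> C) :
  bounded_near0 f -> bounded_near0 g -> bounded_near0 (fun t => f t + g t).
Proof.
  intros [M HM] [M' HM']. exists (M + M')%R. intros t Ht.
  apply Rle_trans with (1 := Cmod_triangle _ _). apply Rplus_le_compat; auto.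
Qed.

Lemma bounded_mult (f g : R -> C) :
  bounded_near0 f -> bounded_near0 g -> bounded_near0 (fun t => f t * g t).
Proof.
  intros [M HM] [M' HM']. exists (M * M')%R. intros t Ht. rewrite Cmod_mult.
  apply Rmult_le_compat; auto using Cmod_ge_0.
Qed.

Lemma bounded_opp (f : R -> C) : bounded_near0 f -> bounded_near0 (fun t => - f t).
Proof. intros [M HM]. exists M. intros t Ht. rewrite Cmod_opp. auto. Qed.

Lemma bounded_minus (f g : R -> C) :
  bounded_near0 f -> bounded_near0 g -> bounded_near0 (fun t => f t - g t).
Proof. intros Hf Hg. apply bounded_plus; [exact Hf|now apply bounded_opp]. Qed.

Lemma bounded_pow (f : R -> C) (k : nat) :
  bounded_near0 f -> bounded_near0 (fun t => f t ^ k).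
Proof.
  intros Hf. induction k as [|k IH]; [apply (bounded_const 1)|].
  now apply (bounded_mult f (fun t => f t ^ k)).
Qed.

Lemma bounded_reflect (f : R -> C) : bounded_near0 f -> bounded_near0 (fun t => f (- t)%R).
Proof. intros [M HM]. exists M. intros t Ht. apply HM. now rewrite Rabs_Ropp. Qed.

Lemma bounded_inv (f : R -> C) :
  (forall t, (Rabs t <= 1 / 100 -> 1 / 2 <= Cmod (f t))%R) ->
  bounded_near0 (fun t => / f t).
Proof.
  intros H. exists 2%R. intros t Ht. specialize (H t Ht).
  rewrite Cmod_inv by (intros E; rewrite E, Cmod_0 in H; lra).
  apply Rmult_le_reg_l with (Cmod (f t)); [lra|]. rewrite Rinv_r; lra.
Qed.

Ltac bounded :=
  repeat first
    [ assumption | apply bounded_const | apply bounded_id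
    | refine (bounded_plus (fun t => _) (fun t => _) _ _)
    | refine (bounded_minus (fun t => _) (fun t => _) _ _)
    | refine (bounded_mult (fun t => _) (fun t => _) _ _)
    | refine (bounded_opp (fun t => _) _)
    | refine (bounded_pow (fun t => _) _ _) ].

(** The only limit process behind the comparisons of coefficients. At the [t] chosen in the proof
    the right-hand side has modulus at most half that of [c]. *)
Lemma eq0_of_eq_mult_bounded (c : C) (g : R -> C) :
  bounded_near0 g -> (forall t, (0 < t <= 1 / 100)%R -> c = RtoC t * g t) -> c = 0.
Proof.
  intros [M HM] H. apply Cmod_eq_0.
  destruct (Rle_lt_dec (Cmod c) 0) as [Hc|Hc]; [generalize (Cmod_ge_0 c); lra|exfalso].
  set (t := Rmin (1 / 100) (Cmod c / (2 * (Rabs M + 1)))).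
  assert (HM' := Rabs_pos M).
  assert (Ht : (0 < t <= 1 / 100)%R).
  { split; [|apply Rmin_l]. apply Rmin_glb_lt; [lra|]. apply Rdiv_lt_0_compat; lra. }
  assert (E : Cmod c = (t * Cmod (g t))%R).
  { rewrite (H t Ht) at 1. rewrite Cmod_mult, Cmod_R, Rabs_pos_eq; lra. }
  assert (Hg : (Cmod (g t) <= M)%R) by (apply HM; rewrite Rabs_pos_eq; lra).
  assert (HMM := Rle_abs M).
  assert (Hle : (t * Cmod (g t) <= Cmod c / (2 * (Rabs M + 1)) * (Rabs M + 1))%R).
  { apply Rmult_le_compat; [lra|apply Cmod_ge_0|apply Rmin_r|lra]. }
  replace (Cmod c / (2 * (Rabs M + 1)) * (Rabs M + 1))%R with (Cmod c / 2)%R in Hle by (field; lra).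
  lra.
Qed.

(* The coefficients of [t^3], [t^4], [t^7] are given through those of the
   logarithm, which are additive on products. *)
Definition jet7 (f : R -> C) (l3 l4 l7 : C) : Prop :=
  exists (c6 : C) (r : R -> C), bounded_near0 r /\
    forall t : R, (Rabs t <= 1 / 100)%R ->
      f t = 1 + l3 * t ^ 3 + l4 * t ^ 4 + c6 * t ^ 6 + (l7 + l3 * l4) * t ^ 7 + t ^ 8 * r t.

Lemma jet7_one : jet7 (fun _ => 1) 0 0 0.
Proof. exists 0, (fun _ => 0). split; [bounded|]. intros; ring. Qed.

Lemma jet7_mult (f g : R -> C) (l3 l4 l7 m3 m4 m7 : C) :
  jet7 f l3 l4 l7 -> jet7 g m3 m4 m7 ->
  jet7 (fun t => f t * g t) (l3 + m3) (l4 + m4) (l7 + m7).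
Proof.
  intros (c & r & Hr & Hf) (d & s & Hs & Hg).
  exists (c + d + l3 * m3),
    (fun t => l4 * m4 + r t + s t
      + (l3 + l4 * t) * (d * t + (m7 + m3 * m4) * t ^ 2 + t ^ 3 * s t)
      + (m3 + m4 * t) * (c * t + (l7 + l3 * l4) * t ^ 2 + t ^ 3 * r t)
      + t ^ 4 * (c + (l7 + l3 * l4) * t + t ^ 2 * r t) * (d + (m7 + m3 * m4) * t + t ^ 2 * s t)).
  split; [bounded|].
  intros t Ht. rewrite Hf, Hg by assumption. ring.
Qed.

Lemma jet7_cprod (f : nat -> R -> C) (l3 l4 l7 : nat -> C) (n : nat) :
  (forall j, (j < n)%nat -> jet7 (f j) (l3 j) (l4 j) (l7 j)) ->
  jet7 (fun t => cprod (fun j => f j t) n) (csum l3 n) (csum l4 n) (csum l7 n).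
Proof.
  intros H. induction n as [|n IH]; [apply jet7_one|].
  apply (jet7_mult (fun t => cprod (fun j => f j t) n) (f n)); auto.
Qed.

Lemma jet7_ext (f g : R -> C) (l3 l4 l7 m3 m4 m7 : C) :
  (forall t, (Rabs t <= 1 / 100)%R -> f t = g t) -> l3 = m3 -> l4 = m4 -> l7 = m7 ->
  jet7 f l3 l4 l7 -> jet7 g m3 m4 m7.
Proof.
  intros E -> -> -> (c & r & Hr & Hf). exists c, r. split; [exact Hr|].
  intros t Ht. rewrite <- E by assumption. auto.
Qed.

Lemma jet7_poly (c3 c4 : C) :
  jet7 (fun t => 1 + c3 * t ^ 3 + c4 * t ^ 4) c3 c4 (- (c3 * c4)).
Proof. exists 0, (fun _ => 0). split; [bounded|]. intros; ring. Qed.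

(** The function is prod_k (1 - z y_k) for y_k = t^3 + i^k t. Its own t^7 coefficient is 0, so the
    logarithmic one is minus the product of those at t^3 and t^4. *)
Lemma jet7_quartic (z : C) :
  jet7 (fun t => (1 - z * t ^ 3) ^ 4 - z ^ 4 * t ^ 4) (- 4 * z) (- z ^ 4) (- 4 * z ^ 5).
Proof.
  exists (6 * z ^ 2), (fun t => - 4 * z ^ 3 * t + z ^ 4 * t ^ 4).
  split; [bounded|]. intros; ring.
Qed.

Lemma Cmod_1_plus_ge (w : C) : (Cmod w <= 1 / 2)%R -> (1 / 2 <= Cmod (1 + w))%R.
Proof.
  intros H. assert (T := Cmod_triangle (1 + w) (- w)).
  replace (1 + w + - w) with (RtoC 1) in T by ring.
  rewrite Cmod_opp, Cmod_1 in T. lra.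
Qed.

Lemma jet7_inv (c : C) :
  (Cmod c <= 4)%R -> jet7 (fun t => / (1 + c * t ^ 3)) (- c) 0 0.
Proof.
  intros Hc.
  assert (Hlow : forall t, (Rabs t <= 1 / 100 -> 1 / 2 <= Cmod (1 + c * RtoC t ^ 3))%R).
  { intros t Ht. apply Cmod_1_plus_ge. rewrite Cmod_mult, Cmod_pow, Cmod_R.
    apply Rle_trans with (4 * (1 / 100) ^ 3)%R; [|lra].
    apply Rmult_le_compat; [apply Cmod_ge_0|apply pow_le, Rabs_pos|exact Hc|].
    apply pow_incr. split; [apply Rabs_pos|exact Ht]. }
  assert (B := bounded_inv _ Hlow).
  exists (c ^ 2), (fun t => - c ^ 3 * t * / (1 + c * t ^ 3)).
  split; [bounded|]. intros t Ht. field.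
  intros E. specialize (Hlow t Ht). rewrite E, Cmod_0 in Hlow. lra.
Qed.

(** Below order 8 the only odd powers in the expansion are t^3 and t^7. The vanishing odd part,
    divided by t^3, first gives c3 = 0 as t tends to 0, and a further division by t^4 then gives c7
    = 0. *)
Lemma jet7_even_coefficients (w : nat -> C) (f : nat -> R -> C) (l3 l4 l7 : nat -> C) (n : nat) :
  (forall k, (k < n)%nat -> jet7 (f k) (l3 k) (l4 k) (l7 k)) ->
  (forall t, (Rabs t <= 1 / 100)%R ->
     csum (fun k => w k * f k t) n = csum (fun k => w k * f k (- t)%R) n) ->
  csum (fun k => w k * l3 k) n = 0 /\
  csum (fun k => w k * (l7 k + l3 k * l4 k)) n = 0.
Proof.
  intros Hj Heven.
  set (c3 := csum (fun k => w k * l3 k) n).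
  set (c7 := csum (fun k => w k * (l7 k + l3 k * l4 k)) n).
  assert (HS : exists (c0 c4 c6 : C) (r : R -> C), bounded_near0 r /\
    forall t : R, (Rabs t <= 1 / 100)%R -> csum (fun k => w k * f k t) n =
      c0 + c3 * t ^ 3 + c4 * t ^ 4 + c6 * t ^ 6 + c7 * t ^ 7 + t ^ 8 * r t).
  { clear Heven. unfold c3, c7. clear c3 c7.
    induction n as [|n IH].
    - exists 0, 0, 0, (fun _ => 0). split; [bounded|]. intros; simpl csum; ring.
    - destruct IH as (c0 & c4 & c6 & r & Hr & HE); [auto|].
      destruct (Hj n ltac:(lia)) as (d & s & Hs & HF).
      exists (c0 + w n), (c4 + w n * l4 n), (c6 + w n * d), (fun t => r t + w n * s t).
      split; [bounded|]. intros t Ht. simpl csum. rewrite HE, HF by assumption. ring. }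
  destruct HS as (c0 & c4 & c6 & r & Hr & HE).
  assert (HO : forall t : R, (0 < t <= 1 / 100)%R ->
    2 * c3 + 2 * c7 * t ^ 4 + t ^ 5 * (r t - r (- t)%R) = 0).
  { intros t Ht. assert (Ha : (Rabs t <= 1 / 100)%R) by (rewrite Rabs_pos_eq; lra).
    assert (E := Heven t Ha). rewrite (HE t Ha) in E.
    rewrite (HE (- t)%R) in E by (now rewrite Rabs_Ropp).
    rewrite RtoC_opp in E.
    assert (Ht0 : RtoC t <> 0) by (intros H; apply RtoC_inj in H; lra).
    apply (Cmult_cancel_l (t ^ 3)); [now apply Cpow_nz|].
    match type of E with ?x = ?y =>
      transitivity (x - y); [ring|rewrite E; ring] end. }
  assert (Hr' := bounded_reflect r Hr).
  assert (H3 : c3 = 0).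
  { apply eq0_of_eq_mult_bounded with (fun t : R => - c7 * t ^ 3 - t ^ 4 * (r t - r (- t)%R) / 2).
    - unfold Cdiv. bounded.
    - intros t Ht. transitivity (c3 - (2 * c3 + 2 * c7 * t ^ 4 + t ^ 5 * (r t - r (- t)%R)) / 2).
      + rewrite (HO t Ht). field.
      + field. }
  split; [exact H3|].
  apply eq0_of_eq_mult_bounded with (fun t : R => - (r t - r (- t)%R) / 2).
  - unfold Cdiv. bounded.
  - intros t Ht. assert (E := HO t Ht). rewrite H3 in E.
    assert (Ht0 : RtoC t <> 0) by (intros H; apply RtoC_inj in H; lra).
    apply (Cmult_cancel_l (2 * t ^ 4)).
    + apply Cmult_neq_0; [intros H; apply RtoC_inj in H; lra|now apply Cpow_nz].
    + transitivity (2 * 0 + 2 * c7 * t ^ 4 + t ^ 5 * (r t - r (- t)%R)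
                    - t ^ 5 * (r t - r (- t)%R)); [ring|rewrite E; field].
Qed.

(** * The identities from e3, e3 e4 and e1 e4 for finite N *)

Fixpoint rsum (f : nat -> R) (n : nat) : R :=
  match n with O => 0%R | S m => (rsum f m + f m)%R end.

Lemma csum_RtoC (f : nat -> R) (n : nat) : csum (fun k => RtoC (f k)) n = RtoC (rsum f n).
Proof. induction n as [|n IH]; simpl; [reflexivity|now rewrite IH, RtoC_plus]. Qed.

Lemma csum_opp (f : nat -> C) (n : nat) : csum (fun k => - f k) n = - csum f n.
Proof. induction n as [|n IH]; simpl; [ring|rewrite IH; ring]. Qed.

Lemma cprod_1 (f : nat -> C) (n : nat) : (forall k, f k = 1) -> cprod f n = 1.
Proof. intros H. induction n as [|n IH]; simpl; [reflexivity|rewrite IH, H; ring]. Qed.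

Definition half_harm (k n : nat) : R := rsum (fun j => / (/ 2 + INR j) ^ k)%R n.

Definition tail_harm (k N n : nat) : R := rsum (fun j => / INR (S (n + j)) ^ k)%R (N - n).

Lemma csum_half_harm (k n : nat) : csum (fun j => (/ hC j) ^ k) n = half_harm k n.
Proof.
  unfold half_harm. rewrite <- csum_RtoC. apply csum_ext. intros j _.
  rewrite hC_eq. assert (H := pos_INR j).
  rewrite RtoC_inv, RtoC_pow, Cpow_inv; try reflexivity.
  - intros E. apply RtoC_inj in E. lra.
  - apply pow_nonzero. lra.
Qed.

Lemma csum_tail_harm (k N n : nat) :
  csum (fun j => (/ nC (S (n + j))) ^ k) (N - n) = tail_harm k N n.
Proof.
  unfold tail_harm. rewrite <- csum_RtoC. apply csum_ext. intros j _.
  rewrite RtoC_inv, RtoC_pow, Cpow_inv; try reflexivity.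
  - apply nC_S_neq0.
  - apply pow_nonzero, not_0_INR. lia.
Qed.

(** The first derivatives of the logarithm of [norm_term] at y = 0 in e1, e3, e4 are [- fin_A],
    [fin_U3], [fin_U4]. Its mixed derivatives in e1, e4 and in e3, e4 are [fin_U5] and
    [- fin_U7]. *)
Definition fin_A (N n : nat) : R :=
  (/ (4 * INR n + 1) + 2 * half_harm 1 n + tail_harm 1 N n
   - (half_harm 1 (N - n) + half_harm 1 (S (N + n))) / 2)%R.
Definition fin_U3 (N n : nat) : R := (half_harm 3 n - tail_harm 3 N n)%R.
Definition fin_U4 (N n : nat) : R := (half_harm 4 n + tail_harm 4 N n)%R.
Definition fin_U5 (N n : nat) : R := (half_harm 5 n + tail_harm 5 N n)%R.
Definition fin_U7 (N n : nat) : R := (half_harm 7 n - tail_harm 7 N n)%R.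

Lemma jet7_norm_term_e34 (N n : nat) (c3 c4 : C) :
  jet7 (fun t : R => norm_term N 0 0 (c3 * t ^ 3) (c4 * t ^ 4) n)
    (c3 * fin_U3 N n) (c4 * fin_U4 N n) (- (c3 * c4) * fin_U7 N n).
Proof.
  set (z := fun j => / hC j). set (z' := fun j => / nC (S (n + j))).
  apply (jet7_ext (fun t : R =>
    cprod (fun j => 1 + (c3 * z j ^ 3) * t ^ 3 + (c4 * z j ^ 4) * t ^ 4) n *
    cprod (fun j => 1 + (- c3 * z' j ^ 3) * t ^ 3 + (c4 * z' j ^ 4) * t ^ 4) (N - n)) _
    (csum (fun j => c3 * z j ^ 3) n + csum (fun j => - c3 * z' j ^ 3) (N - n))
    (csum (fun j => c4 * z j ^ 4) n + csum (fun j => c4 * z' j ^ 4) (N - n))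
    (csum (fun j => - (c3 * c4) * z j ^ 7) n + csum (fun j => c3 * c4 * z' j ^ 7) (N - n))).
  - intros t _. unfold norm_term. replace ((1 - 0) / 2) with (/ 2) by field.
    rewrite (cprod_1 (fun j => (/ 2 + nC j) / hC j))
      by (intros k; unfold Cdiv; fold (hC k); apply Cinv_r, hC_neq0).
    rewrite (cprod_1 (fun j => (1 - / 2 + nC j) / hC j)).
    2: { intros k. replace (1 - / 2 + nC k) with (hC k) by (unfold hC; field).
         apply Cinv_r, hC_neq0. }
    rewrite (cprod_1 (fun j => hC j / (/ 2 + nC j)))
      by (intros k; unfold Cdiv; fold (hC k); apply Cinv_r, hC_neq0).
    rewrite (cprod_ext (fun j => quartic 0 0 (c3 * t ^ 3) (c4 * t ^ 4) (/ 2 + nC j) / hC j ^ 4)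
      (fun j => 1 + (c3 * z j ^ 3) * t ^ 3 + (c4 * z j ^ 4) * t ^ 4)).
    2: { intros j _. fold (hC j). unfold quartic, z. field. apply hC_neq0. }
    rewrite (cprod_ext (fun j => quartic (- 0) 0 (- (c3 * t ^ 3)) (c4 * t ^ 4)
         (nC (S (n + j))) / nC (S (n + j)) ^ 4)
      (fun j => 1 + (- c3 * z' j ^ 3) * t ^ 3 + (c4 * z' j ^ 4) * t ^ 4)).
    2: { intros j _. unfold quartic, z'. field. apply nC_S_neq0. }
    field. intros E. apply (hC_neq0 (n + n)). unfold hC. rewrite nC_add.
    transitivity ((1 + 2 * 2 * nC n) / 2); [field|].
    replace (1 + 2 * 2 * nC n) with (1 + 2 * nC n * 2) by ring. rewrite E. field.
  - rewrite !csum_scal. unfold z, z'. rewrite csum_half_harm, csum_tail_harm.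
    unfold fin_U3. rewrite RtoC_minus. ring.
  - rewrite !csum_scal. unfold z, z'. rewrite csum_half_harm, csum_tail_harm.
    unfold fin_U4. rewrite RtoC_plus. ring.
  - rewrite !csum_scal. unfold z, z'. rewrite csum_half_harm, csum_tail_harm.
    unfold fin_U7. rewrite RtoC_minus. ring.
  - apply (jet7_mult (fun t : R => cprod _ n) (fun t : R => cprod _ (N - n)));
      apply (jet7_cprod (fun j t => _)); intros j _.
    + replace (- (c3 * c4) * z j ^ 7) with (- (c3 * z j ^ 3 * (c4 * z j ^ 4))) by ring.
      apply jet7_poly.
    + replace (c3 * c4 * z' j ^ 7) with (- (- c3 * z' j ^ 3 * (c4 * z' j ^ 4))) by ring.
      apply jet7_poly.
Qed.

Lemma jet7_linear (c : C) : jet7 (fun t => 1 + c * t ^ 3) c 0 0.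
Proof. exists 0, (fun _ => 0). split; [bounded|]. intros; ring. Qed.

Lemma Cmod_inv_hC (j : nat) : (Cmod (/ hC j) <= 2)%R.
Proof.
  rewrite hC_eq, <- RtoC_inv, Cmod_R. 2: { assert (H := pos_INR j); lra. }
  assert (H := pos_INR j).
  rewrite Rabs_pos_eq by (apply Rlt_le, Rinv_0_lt_compat; lra).
  replace 2%R with (/ / 2)%R by field. apply Rinv_le_contravar; lra.
Qed.

Lemma shifted_half_neq0 (t : R) (j : nat) :
  (Rabs t <= 1 / 100)%R -> (1 - 4 * t ^ 3) / 2 + nC j <> 0.
Proof.
  intros Ht. replace ((1 - 4 * t ^ 3) / 2 + nC j) with (RtoC (/ 2 - 2 * t ^ 3 + INR j)).
  - intros E. apply RtoC_inj in E. assert (H := pos_INR j).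
    assert (Hp : (Rabs (t ^ 3) <= (1 / 100) ^ 3)%R).
    { rewrite <- RPow_abs. apply pow_incr. split; [apply Rabs_pos|exact Ht]. }
    apply Rabs_le_between in Hp. lra.
  - unfold nC. rewrite RtoC_plus, RtoC_minus, RtoC_inv, RtoC_mult, RtoC_pow by lra. field.
Qed.

Lemma jet7_norm_term_e14 (N n : nat) :
  jet7 (fun t : R => norm_term N (4 * t ^ 3) (6 * t ^ 6) (4 * t ^ 9) (t ^ 12 - t ^ 4) n)
    (- 4 * fin_A N n) (- fin_U4 N n) (- 4 * fin_U5 N n).
Proof.
  set (z := fun j => / hC j). set (z' := fun j => / nC (S (n + j))).
  set (d := / (1 + 4 * nC n)).
  assert (Hd : 1 + 4 * nC n <> 0).
  { apply neq0_of_Re_pos. assert (H := pos_INR n). simpl. lra. }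
  apply (jet7_ext (fun t : R => (1 + (- 4 * d) * t ^ 3) *
    (cprod (fun j => 1 + (- 2 * z j) * t ^ 3) n * cprod (fun j => 1 + (- 2 * z j) * t ^ 3) n) *
    cprod (fun j => 1 + (2 * z j) * t ^ 3) (N - n) *
    cprod (fun j => / (1 + (- 2 * z j) * t ^ 3)) (S (N + n)) *
    cprod (fun j => (1 - z j * t ^ 3) ^ 4 - z j ^ 4 * t ^ 4) n *
    cprod (fun j => (1 - z' j * t ^ 3) ^ 4 - z' j ^ 4 * t ^ 4) (N - n)) _
    ((- 4 * d) + (csum (fun j => - 2 * z j) n + csum (fun j => - 2 * z j) n) +
     csum (fun j => 2 * z j) (N - n) + csum (fun j => - (- 2 * z j)) (S (N + n)) +
     csum (fun j => - 4 * z j) n + csum (fun j => - 4 * z' j) (N - n))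
    (0 + (csum (fun _ => 0) n + csum (fun _ => 0) n) + csum (fun _ => 0) (N - n) +
     csum (fun _ => 0) (S (N + n)) +
     csum (fun j => - z j ^ 4) n + csum (fun j => - z' j ^ 4) (N - n))
    (0 + (csum (fun _ => 0) n + csum (fun _ => 0) n) + csum (fun _ => 0) (N - n) +
     csum (fun _ => 0) (S (N + n)) +
     csum (fun j => - 4 * z j ^ 5) n + csum (fun j => - 4 * z' j ^ 5) (N - n))).
  - intros t Ht. unfold norm_term.
    replace ((1 - 4 * t ^ 3) / 2) with (/ 2 - 2 * t ^ 3) by field.
    assert (E1 : forall j, (/ 2 - 2 * t ^ 3 + nC j) / hC j = 1 + - 2 * z j * t ^ 3).
    { intros j. unfold z. replace (/ 2 - 2 * t ^ 3 + nC j) with (hC j - 2 * t ^ 3)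
        by (unfold hC; ring). field. apply hC_neq0. }
    assert (E2 : forall j, / 2 - 2 * t ^ 3 + nC j <> 0).
    { intros j. replace (/ 2 - 2 * t ^ 3 + nC j) with ((1 - 4 * t ^ 3) / 2 + nC j) by field.
      now apply shifted_half_neq0. }
    rewrite (cprod_ext (fun j => (/ 2 - 2 * t ^ 3 + nC j) / hC j) _ n (fun j _ => E1 j)).
    rewrite (cprod_ext (fun j => (1 - (/ 2 - 2 * t ^ 3) + nC j) / hC j)
       (fun j => 1 + 2 * z j * t ^ 3)).
    2: { intros j _. unfold z. replace (1 - (/ 2 - 2 * t ^ 3) + nC j) with (hC j + 2 * t ^ 3)
        by (unfold hC; field). field. apply hC_neq0. }
    rewrite (cprod_ext (fun j => hC j / (/ 2 - 2 * t ^ 3 + nC j))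
       (fun j => / (1 + - 2 * z j * t ^ 3))).
    2: { intros j _. rewrite <- E1. generalize (E2 j). generalize (/ 2 - 2 * t ^ 3 + nC j).
         intros x Hx. field. split; [apply hC_neq0|exact Hx]. }
    (* Since a = 1/2 - 2 t^3, the shift turns t^3 + i^k t into -t^3 + i^k t, and both quartics take
       the form treated in [jet7_quartic]. *)
    rewrite (cprod_ext (fun j => quartic _ _ _ _ (/ 2 - 2 * t ^ 3 + nC j) / hC j ^ 4)
      (fun j => (1 - z j * t ^ 3) ^ 4 - z j ^ 4 * t ^ 4)).
    2: { intros j _. replace (/ 2 - 2 * t ^ 3 + nC j) with (hC j - 2 * t ^ 3)
        by (unfold hC; ring). unfold quartic, z. field. apply hC_neq0. }
    rewrite (cprod_ext (fun j => quartic _ _ _ _ (nC (S (n + j))) / nC (S (n + j)) ^ 4)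
      (fun j => (1 - z' j * t ^ 3) ^ 4 - z' j ^ 4 * t ^ 4)).
    2: { intros j _. unfold quartic, z'. field. apply nC_S_neq0. }
    replace ((/ 2 - 2 * t ^ 3 + 2 * nC n) / (/ 2 + 2 * nC n)) with (1 + - 4 * d * t ^ 3).
    + ring.
    + unfold d. field. intros E. apply Hd. rewrite <- E. ring.
  - rewrite csum_opp, !csum_scal. unfold z, z'.
    assert (E : forall m, csum (fun j => / hC j) m = half_harm 1 m).
    { intros m. rewrite <- csum_half_harm. apply csum_ext. intros; ring. }
    rewrite !E. rewrite (csum_ext (fun j => / nC (S (n + j))) (fun j => (/ nC (S (n + j))) ^ 1))
      by (intros; ring).
    rewrite csum_tail_harm. unfold fin_A, d.
    replace (4 * INR n + 1)%R with (1 + 4 * INR n)%R by ring.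
    assert (Hn := pos_INR n).
    rewrite RtoC_minus, !RtoC_plus, RtoC_div, RtoC_inv, !RtoC_plus, !RtoC_mult by lra.
    fold (nC n). field. exact Hd.
  - assert (E : forall m, csum (fun _ => 0) m = 0)
      by (intros m; induction m as [|m IH]; simpl; [|rewrite IH]; ring).
    rewrite !E, !csum_opp. unfold z, z'. rewrite csum_half_harm, csum_tail_harm.
    unfold fin_U4. rewrite RtoC_plus. ring.
  - assert (E : forall m, csum (fun _ => 0) m = 0)
      by (intros m; induction m as [|m IH]; simpl; [|rewrite IH]; ring).
    rewrite !E, !csum_scal. unfold z, z'. rewrite csum_half_harm, csum_tail_harm.
    unfold fin_U5. rewrite RtoC_plus. ring.
  - let m := (apply (jet7_mult (fun t : R => _) (fun t : R => _))) in
      m; [m; [m; [m; [m; [|m]|]|]|]|];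
      try apply jet7_linear; apply (jet7_cprod (fun j t => _)); intros j _;
      try apply jet7_linear; try apply jet7_quartic.
    apply jet7_inv. rewrite Cmod_mult, Cmod_R. assert (H := Cmod_inv_hC j).
    rewrite Rabs_left by lra. unfold z. lra.
Qed.

Lemma RtoC_neq0 (x : R) : (x <> 0)%R -> RtoC x <> 0.
Proof. intros Hx E. apply RtoC_inj in E. contradiction. Qed.

Lemma rsum_eq0_of_csum (w f : nat -> R) (c : C) (g : nat -> C) (n : nat) :
  c <> 0 -> (forall k, g k = c * RtoC (f k)) ->
  csum (fun k => RtoC (w k) * g k) n = 0 -> rsum (fun k => w k * f k)%R n = 0%R.
Proof.
  intros Hc Hg H. apply RtoC_inj. apply (Cmult_cancel_l c); [exact Hc|].
  rewrite <- csum_RtoC, <- csum_scal, Cmult_0_r, <- H. apply csum_ext.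
  intros k _. rewrite Hg, RtoC_mult. ring.
Qed.

(** The radius 1/100 is small enough for slopes up to 5, the largest among the real parts of the
    explicit roots. *)
Lemma small_Re (x t : R) : (Rabs x <= 5 -> Rabs t <= 1 / 100 -> Rabs (x * t) < 1 / 4)%R.
Proof.
  intros Hx Ht. rewrite Rabs_mult.
  apply Rle_lt_trans with (5 * (1 / 100))%R; [|lra].
  apply Rmult_le_compat; auto using Rabs_pos.
Qed.

Lemma Ci_sqr : Ci * Ci = - (1).
Proof. unfold Ci. apply injective_projections; simpl; ring. Qed.

(* The values t(-5+-i), t(5+-7i) of the y_i have e1 = e2 = 0, e3 = -480 t^3,
   e4 = 1924 t^4. *)
Lemma finite_identities_e34 (N : nat) :
  rsum (fun n => q n * rho N n * fin_U3 N n)%R (S N) = 0%R /\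
  rsum (fun n => q n * rho N n * (fin_U3 N n * fin_U4 N n - fin_U7 N n))%R (S N) = 0%R.
Proof.
  (* Two pairs -p +- ri and p +- si have e1 = 0, and e2 = 0 exactly when r^2 + s^2 = 2 p^2. The
     solution 1 + 49 = 2 * 25 has r and s distinct, which keeps e3 nonzero. *)
  destruct (jet7_even_coefficients (fun n => RtoC (q n * rho N n))
    (fun n (t : R) => norm_term N 0 0 (- 480 * t ^ 3) (1924 * t ^ 4) n)
    (fun n => - 480 * fin_U3 N n) (fun n => 1924 * fin_U4 N n)
    (fun n => - (- 480 * 1924) * fin_U7 N n) (S N)) as [H3 H7].
  - intros n _. apply jet7_norm_term_e34.
  - intros t Ht.
    assert (HI := Ci_sqr).
    assert (E : forall s : R, omega N 0 0 (- 480 * s ^ 3) (1924 * s ^ 4) =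
      omega_roots N ((- (5) + Ci) * s) ((- (5) - Ci) * s) ((5 + 7 * Ci) * s) ((5 - 7 * Ci) * s)).
    { intros s. unfold omega_roots. f_equal; ring [HI]. }
    apply norm_sum_eq_of_omega_eq.
    1,2: intros j; apply neq0_of_Re_pos; assert (Hj := pos_INR j);
      unfold Cminus; rewrite Re_plus, Re_half, Re_plus, Re_opp, Re_nC; simpl; lra.
    rewrite !E, omega_roots_opp.
    + f_equal; rewrite RtoC_opp; ring.
    + replace (Re _) with (- 5 * t)%R by (simpl; ring). apply small_Re; [|exact Ht].
      apply Rabs_le; lra.
    + replace (Re _) with (- 5 * t)%R by (simpl; ring). apply small_Re; [|exact Ht].
      apply Rabs_le; lra.
    + replace (Re _) with (5 * t)%R by (simpl; ring). apply small_Re; [|exact Ht].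
      apply Rabs_le; lra.
    + replace (Re _) with (5 * t)%R by (simpl; ring). apply small_Re; [|exact Ht].
      apply Rabs_le; lra.
  - split.
    + apply (rsum_eq0_of_csum (fun n => q n * rho N n)%R _ (- 480) _ (S N)) with (3 := H3);
        [apply RtoC_neq0; lra|].
      reflexivity.
    + apply (rsum_eq0_of_csum (fun n => q n * rho N n)%R _ (- 480 * 1924) _ (S N))
        with (3 := H7); [apply Cmult_neq_0; apply RtoC_neq0; lra|].
      intros k. rewrite RtoC_minus, !RtoC_mult. ring.
Qed.

(* For y_k = t^3 + i^k t the coefficient of t^7 is that of e1 e4, because e1 = 4 t^3,
   e4 = - t^4 up to higher order, and e2, e3 have order at least t^6. *)
Lemma finite_identity_e14 (N : nat) :
  rsum (fun n => q n * rho N n * (fin_A N n * fin_U4 N n - fin_U5 N n))%R (S N) = 0%R.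
Proof.
  destruct (jet7_even_coefficients (fun n => RtoC (q n * rho N n))
    (fun n (t : R) => norm_term N (4 * t ^ 3) (6 * t ^ 6) (4 * t ^ 9) (t ^ 12 - t ^ 4) n)
    (fun n => - 4 * fin_A N n) (fun n => - fin_U4 N n)
    (fun n => - 4 * fin_U5 N n) (S N)) as [_ H7].
  - intros n _. apply jet7_norm_term_e14.
  - intros t Ht.
    assert (HI := Ci_sqr).
    assert (E : forall s : R, omega N (4 * s ^ 3) (6 * s ^ 6) (4 * s ^ 9) (s ^ 12 - s ^ 4) =
      omega_roots N ((1 + s ^ 2) * s) ((Ci + s ^ 2) * s) ((- (1) + s ^ 2) * s)
        ((- Ci + s ^ 2) * s)).
    { intros s. unfold omega_roots. f_equal; ring [HI]. }
    apply norm_sum_eq_of_omega_eq.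
    1,2: intros j; apply shifted_half_neq0; rewrite ?Rabs_Ropp; exact Ht.
    assert (Ht2 : (0 <= t ^ 2 <= 1)%R).
    { split; [apply pow2_ge_0|]. rewrite <- pow2_abs.
      apply Rle_trans with ((1 / 100) ^ 2)%R; [|lra].
      apply pow_incr. split; [apply Rabs_pos|exact Ht]. }
    rewrite !E, omega_roots_opp.
    + f_equal; rewrite RtoC_opp; ring.
    + rewrite <- RtoC_pow. replace (Re _) with ((1 + t ^ 2) * t)%R by (simpl; ring).
      apply small_Re; [|exact Ht]. apply Rabs_le; lra.
    + rewrite <- RtoC_pow. replace (Re _) with ((t ^ 2) * t)%R by (simpl; ring).
      apply small_Re; [|exact Ht]. apply Rabs_le; lra.
    + rewrite <- RtoC_pow. replace (Re _) with ((- 1 + t ^ 2) * t)%R by (simpl; ring).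
      apply small_Re; [|exact Ht]. apply Rabs_le; lra.
    + rewrite <- RtoC_pow. replace (Re _) with ((t ^ 2) * t)%R by (simpl; ring).
      apply small_Re; [|exact Ht]. apply Rabs_le; lra.
  - apply (rsum_eq0_of_csum (fun n => q n * rho N n)%R _ 4 _ (S N)) with (3 := H7);
      [apply RtoC_neq0; lra|].
    intros k. rewrite RtoC_minus, !RtoC_mult. ring.
Qed.

(** * The degree 6 identity on the slice p2 = 0 *)

Lemma eq0_of_affine_bounded (c : C) (g : R -> C) :
  bounded_near0 g -> (forall t : R, (0 < t <= 1 / 100)%R -> c + t * g t = 0) ->
  c = 0 /\ forall t : R, (0 < t <= 1 / 100)%R -> g t = 0.
Proof.
  intros Hb HE. assert (Hc : c = 0).
  { apply eq0_of_eq_mult_bounded with (fun t : R => - g t); [bounded|].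
    intros t Ht. transitivity (c + t * g t - t * g t); [ring|rewrite HE by exact Ht; ring]. }
  split; [exact Hc|]. intros t Ht. specialize (HE t Ht). rewrite Hc in HE.
  apply (Cmult_cancel_l t); [intros E; apply RtoC_inj in E; lra|].
  rewrite Cmult_0_r, <- HE. ring.
Qed.

Definition jet1 (f : R -> C) (l : C) : Prop :=
  exists r : R -> C, bounded_near0 r /\
    forall x : R, (Rabs x <= 1 / 100)%R -> f x = 1 + l * x + x ^ 2 * r x.

Lemma jet1_mult (f g : R -> C) (l m : C) :
  jet1 f l -> jet1 g m -> jet1 (fun x : R => f x * g x) (l + m).
Proof.
  intros (r & Hr & Hf) (s & Hs & Hg).
  exists (fun x : R => l * m + r x + s x + x * (l * s x + m * r x) + x ^ 2 * (r x * s x)).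
  split; [bounded|]. intros x Hx. rewrite Hf, Hg by assumption. ring.
Qed.

Lemma jet1_cprod (b : nat -> C) (n : nat) :
  jet1 (fun x : R => cprod (fun j => 1 + x * b j) n) (csum b n).
Proof.
  induction n as [|n IH].
  - exists (fun _ => 0). split; [bounded|]. intros; simpl; ring.
  - apply (jet1_mult (fun x : R => cprod (fun j => 1 + x * b j) n)
             (fun x : R => 1 + x * b n)); [exact IH|].
    exists (fun _ => 0). split; [bounded|]. intros; ring.
Qed.

Definition poly3 (f : R -> C) (m0 m1 m2 m3 : C) : Prop :=
  exists r : R -> C, bounded_near0 r /\
    forall t : R, (Rabs t <= 1 / 100)%R ->
      f t = m0 + m1 * t + m2 * t ^ 2 + m3 * t ^ 3 + t ^ 4 * r t.

Lemma poly3_plus (f g : R -> C) (m0 m1 m2 m3 n0 n1 n2 n3 : C) :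
  poly3 f m0 m1 m2 m3 -> poly3 g n0 n1 n2 n3 ->
  poly3 (fun t : R => f t + g t) (m0 + n0) (m1 + n1) (m2 + n2) (m3 + n3).
Proof.
  intros (r & Hr & Hf) (s & Hs & Hg). exists (fun t : R => r t + s t).
  split; [bounded|]. intros t Ht. rewrite Hf, Hg by assumption. ring.
Qed.

Lemma poly3_mult (f g : R -> C) (m0 m1 m2 m3 n0 n1 n2 n3 : C) :
  poly3 f m0 m1 m2 m3 -> poly3 g n0 n1 n2 n3 ->
  poly3 (fun t : R => f t * g t) (m0 * n0) (m0 * n1 + m1 * n0) (m0 * n2 + m1 * n1 + m2 * n0)
    (m0 * n3 + m1 * n2 + m2 * n1 + m3 * n0).
Proof.
  intros (r & Hr & Hf) (s & Hs & Hg).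
  exists (fun t : R => m1 * n3 + m2 * n2 + m3 * n1 + t * (m2 * n3 + m3 * n2) + t ^ 2 * (m3 * n3)
    + (m0 + m1 * t + m2 * t ^ 2 + m3 * t ^ 3) * s t
    + (n0 + n1 * t + n2 * t ^ 2 + n3 * t ^ 3) * r t + t ^ 4 * (r t * s t)).
  split; [bounded|]. intros t Ht. rewrite Hf, Hg by assumption. ring.
Qed.

Lemma poly3_const (c : C) : poly3 (fun _ => c) c 0 0 0.
Proof. exists (fun _ => 0). split; [bounded|]. intros; ring. Qed.

Lemma poly3_csum (f : nat -> R -> C) (m0 m1 m2 m3 : nat -> C) (n : nat) :
  (forall j, (j < n)%nat -> poly3 (f j) (m0 j) (m1 j) (m2 j) (m3 j)) ->
  poly3 (fun t : R => csum (fun j => f j t) n) (csum m0 n) (csum m1 n) (csum m2 n) (csum m3 n).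
Proof.
  intros H. induction n as [|n IH]; [apply (poly3_const 0)|].
  apply (poly3_plus (fun t : R => csum (fun j => f j t) n) (f n)); auto.
Qed.

Lemma poly3_ext (f g : R -> C) (m0 m1 m2 m3 n0 n1 n2 n3 : C) :
  (forall t, (Rabs t <= 1 / 100)%R -> f t = g t) ->
  m0 = n0 -> m1 = n1 -> m2 = n2 -> m3 = n3 ->
  poly3 f m0 m1 m2 m3 -> poly3 g n0 n1 n2 n3.
Proof.
  intros E -> -> -> -> (r & Hr & Hf). exists r. split; [exact Hr|].
  intros t Ht. rewrite <- E by assumption. auto.
Qed.

Lemma poly3_coefficient_unique (f : R -> C) (m0 m1 m2 m3 n0 n1 n2 n3 : C) :
  poly3 f m0 m1 m2 m3 -> poly3 f n0 n1 n2 n3 -> m3 = n3.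
Proof.
  intros (r & Hr & Hf) (s & Hs & Hg).
  assert (HE : forall t : R, (0 < t <= 1 / 100)%R -> (m0 - n0) + (m1 - n1) * t +
    (m2 - n2) * t ^ 2 + (m3 - n3) * t ^ 3 + t ^ 4 * (r t - s t) = 0).
  { intros t Ht. assert (Ha : (Rabs t <= 1 / 100)%R) by (rewrite Rabs_pos_eq; lra).
    transitivity (f t - f t); [|ring]. rewrite (Hf t Ha) at 1. rewrite (Hg t Ha). ring. }
  destruct (eq0_of_affine_bounded (m0 - n0) 
    (fun t : R => (m1 - n1) + t * ((m2 - n2) + t * ((m3 - n3) + t * (r t - s t)))))
    as [_ H1]; [bounded|intros t Ht; rewrite <- (HE t Ht); ring|].
  destruct (eq0_of_affine_bounded (m1 - n1)
    (fun t : R => (m2 - n2) + t * ((m3 - n3) + t * (r t - s t))))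
    as [_ H2]; [bounded|exact H1|].
  destruct (eq0_of_affine_bounded (m2 - n2) (fun t : R => (m3 - n3) + t * (r t - s t)))
    as [_ H3]; [bounded|exact H2|].
  destruct (eq0_of_affine_bounded (m3 - n3) (fun t : R => r t - s t))
    as [H4 _]; [bounded|exact H3|].
  transitivity (m3 - n3 + n3); [ring|rewrite H4; ring].
Qed.

(* As in [jet7], the parameters are the coefficients of the logarithm. *)
Definition jet3 (f : R -> C) (l1 l2 l3 : C) : Prop :=
  poly3 f 1 l1 (l2 + l1 ^ 2 / 2) (l3 + l1 * l2 + l1 ^ 3 / 6).

Lemma jet3_mult (f g : R -> C) (l1 l2 l3 m1 m2 m3 : C) :
  jet3 f l1 l2 l3 -> jet3 g m1 m2 m3 ->
  jet3 (fun t : R => f t * g t) (l1 + m1) (l2 + m2) (l3 + m3).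
Proof.
  intros Hf Hg. unfold jet3.
  refine (poly3_ext _ _ _ _ _ _ _ _ _ _ _ _ _ _ _ (poly3_mult f g _ _ _ _ _ _ _ _ Hf Hg));
    [reflexivity| | | |]; field.
Qed.

Lemma jet3_cprod (f : nat -> R -> C) (l1 l2 l3 : nat -> C) (n : nat) :
  (forall j, (j < n)%nat -> jet3 (f j) (l1 j) (l2 j) (l3 j)) ->
  jet3 (fun t : R => cprod (fun j => f j t) n) (csum l1 n) (csum l2 n) (csum l3 n).
Proof.
  intros H. induction n as [|n IH].
  - refine (poly3_ext _ _ _ _ _ _ _ _ _ _ _ _ _ _ _ (poly3_const 1));
      [reflexivity| | | |]; simpl; field.
  - apply (jet3_mult (fun t : R => cprod (fun j => f j t) n) (f n)); auto.
Qed.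

Lemma jet3_ext (f g : R -> C) (l1 l2 l3 m1 m2 m3 : C) :
  (forall t, (Rabs t <= 1 / 100)%R -> f t = g t) ->
  l1 = m1 -> l2 = m2 -> l3 = m3 -> jet3 f l1 l2 l3 -> jet3 g m1 m2 m3.
Proof.
  intros E -> -> -> H. unfold jet3 in *.
  eapply poly3_ext; [exact E| | | | |exact H]; reflexivity.
Qed.

Lemma jet3_linear (c : C) : jet3 (fun t : R => 1 + c * t) c (- c ^ 2 / 2) (c ^ 3 / 3).
Proof. exists (fun _ => 0). split; [bounded|]. intros; field. Qed.

Lemma jet3_inv_linear (c : C) :
  (Cmod c <= 4)%R -> jet3 (fun t : R => / (1 + c * t)) (- c) (c ^ 2 / 2) (- c ^ 3 / 3).
Proof.
  intros Hc.
  assert (Hlow : forall t, (Rabs t <= 1 / 100 -> 1 / 2 <= Cmod (1 + c * RtoC t))%R).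
  { intros t Ht. apply Cmod_1_plus_ge. rewrite Cmod_mult, Cmod_R.
    apply Rle_trans with (4 * (1 / 100))%R; [|lra].
    apply Rmult_le_compat; auto using Cmod_ge_0, Rabs_pos. }
  assert (B := bounded_inv _ Hlow).
  exists (fun t : R => c ^ 4 * / (1 + c * t)).
  split; [bounded|]. intros t Ht. field.
  intros E. specialize (Hlow t Ht). rewrite E, Cmod_0 in Hlow. lra.
Qed.

Lemma cubic_lower_bound (z a b c : C) (t : R) :
  (Cmod z <= 2)%R -> (Cmod a <= 5)%R -> (Cmod b <= 5)%R -> (Cmod c <= 5)%R ->
  (Rabs t <= 1 / 100)%R ->
  (1 / 2 <= Cmod (1 + a * (z * t) + b * (z * t) ^ 2 + c * (z * t) ^ 3))%R.
Proof.
  intros Hz Ha Hb Hc Ht.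
  replace (1 + a * (z * t) + b * (z * t) ^ 2 + c * (z * t) ^ 3) with
    (1 + z * t * (a + z * t * (b + z * t * c))) by ring.
  assert (Hu : (Cmod (z * t) <= 1 / 50)%R).
  { rewrite Cmod_mult, Cmod_R. apply Rle_trans with (2 * (1 / 100))%R; [|lra].
    apply Rmult_le_compat; auto using Cmod_ge_0, Rabs_pos. }
  apply Cmod_1_plus_ge.
  assert (T : forall x y, (Cmod x <= 5 -> Cmod y <= 6 -> Cmod (x + z * t * y) <= 6)%R).
  { intros x y Hx Hy. apply Rle_trans with (1 := Cmod_triangle _ _).
    rewrite Cmod_mult. assert (H0 := Cmod_ge_0 (z * t)). assert (H1 := Cmod_ge_0 y). nra. }
  assert (H2 : (Cmod (b + z * t * c) <= 6)%R) by (apply T; lra).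
  assert (H3 := T a _ Ha H2). rewrite Cmod_mult.
  assert (H0 := Cmod_ge_0 (z * t)).
  assert (H1 := Cmod_ge_0 (a + z * t * (b + z * t * c))). nra.
Qed.

Lemma poly3_inv_cubic (z a b c : C) :
  (Cmod z <= 2)%R -> (Cmod a <= 5)%R -> (Cmod b <= 5)%R -> (Cmod c <= 5)%R ->
  poly3 (fun t : R => / (1 + a * (z * t) + b * (z * t) ^ 2 + c * (z * t) ^ 3))
    1 (- a * z) ((a ^ 2 - b) * z ^ 2) ((2 * a * b - c - a ^ 3) * z ^ 3).
Proof.
  intros Hz Ha Hb Hc.
  assert (Hlow := fun t Ht => cubic_lower_bound z a b c t Hz Ha Hb Hc Ht).
  assert (B := bounded_inv _ Hlow).
  (* The exact remainder: 1 minus the product of the truncated inverse with the cubic, divided by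
     t^4 and by the cubic. *)
  exists (fun t : R => z ^ 4 * (a ^ 4 - 3 * a ^ 2 * b + 2 * a * c + b ^ 2
                   + z * t * (a ^ 3 * b - a ^ 2 * c - 2 * a * b ^ 2 + 2 * b * c)
                   + (z * t) ^ 2 * (a ^ 3 * c - 2 * a * b * c + c ^ 2))
                * / (1 + a * (z * t) + b * (z * t) ^ 2 + c * (z * t) ^ 3)).
  split; [bounded|]. intros t Ht. field.
  intros E. specialize (Hlow t Ht). rewrite E, Cmod_0 in Hlow. lra.
Qed.

(** On the slice the quartics contribute nothing to the t^2 coefficient of the logarithm, which
    becomes - theta^2 [fin_R] from the factors in a. Together with the first coefficient 2 theta
    [fin_A], the t^2 coefficient of [norm_term] itself is 2 theta^2 [fin_X]. *)
Definition fin_R (N n : nat) : R :=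
  (2 / (4 * INR n + 1) ^ 2 + half_harm 2 n
   + (half_harm 2 (N - n) - half_harm 2 (S (N + n))) / 2)%R.
Definition fin_X (N n : nat) : R := (fin_A N n ^ 2 - 1 / 2 * fin_R N n)%R.

(** The part of the third logarithmic coefficient on the slice that is the same for sigma and
    -sigma; it cancels when y1 is flipped. *)
Definition fin_K (N n : nat) : R :=
  (((2 / (4 * INR n + 1)) ^ 3 + 2 * half_harm 3 n - half_harm 3 (N - n)
    - half_harm 3 (S (N + n))) / 3 + 2 / 3 * half_harm 3 n - 4 / 3 * tail_harm 3 N n)%R.

(** A product of factors 1 + u_i t in which the squares of the u_i sum to zero has e2 = e1^2 / 2,
    and so no t^2 term in its logarithm. *)
Lemma jet3_quartic (c1 c3 c4 : C) :
  jet3 (fun t : R => 1 + c1 * t + c1 ^ 2 / 2 * t ^ 2 + c3 * t ^ 3 + c4 * t ^ 4)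
    c1 0 (c3 - c1 ^ 3 / 6).
Proof. exists (fun _ => c4). split; [bounded|]. intros; field. Qed.

Lemma Cmod_inv_nC_S (j : nat) : (Cmod (/ nC (S j)) <= 2)%R.
Proof.
  unfold nC. assert (H := pos_INR j).
  rewrite <- RtoC_inv, Cmod_R; rewrite S_INR; [|lra].
  rewrite Rabs_pos_eq by (apply Rlt_le, Rinv_0_lt_compat; lra).
  apply Rle_trans with (/ 1)%R; [apply Rinv_le_contravar; lra|lra].
Qed.

Lemma Cmod_half (x : C) : Cmod (x / 2) = (Cmod x / 2)%R.
Proof.
  unfold Cdiv. rewrite Cmod_mult, Cmod_inv, Cmod_R, Rabs_pos_eq; [reflexivity|lra|].
  apply RtoC_neq0; lra.
Qed.

(* For sigma^2 = -3, [theta sigma] is a primitive cube root of unity. The slice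
   y1 = sigma t, with the other y_i given by the cubic with coefficients t, -t^2, x,
   has power sum p2 = 0, and flipping y1 amounts to sigma -> -sigma;
   its parameter is a = 1/2 + theta t. The pure powers of t are discarded by
   taking the part linear in x, whose t^3-coefficient, odd in sigma, is the wanted one. *)
Definition theta (sigma : C) : C := - (1 + sigma) / 2.

Definition slice_term (sigma : C) (N n : nat) (t x : R) : C :=
  norm_term N ((1 + sigma) * t) ((sigma - 1) * t ^ 2) (x - sigma * t ^ 3) (sigma * t * x) n.

(** This is 1 / (y^3 + t y^2 - t^2 y) at y = [hC j] + theta t, the x-derivative at x = 0 of the
    logarithm of the cubic factor; the form 1 + ... of the denominator prepares the expansion in t.
    [slice_pole2] is its counterpart for the quartics at the integers. *)
Definition slice_pole1 (sigma : C) (t : R) (j : nat) : C :=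
  (/ hC j) ^ 3 * / (1 + (- (1 + 3 * sigma) / 2) * (/ hC j * t)
     + (sigma - 7) / 2 * (/ hC j * t) ^ 2 + (1 + sigma) * (/ hC j * t) ^ 3).

Definition slice_pole2 (t : R) (j : nat) : C :=
  - (/ nC (S j)) ^ 3 * / (1 + (- (1)) * (/ nC (S j) * t)
     + (- (1)) * (/ nC (S j) * t) ^ 2 + 0 * (/ nC (S j) * t) ^ 3).

Definition slice_log_deriv (sigma : C) (N n : nat) (t : R) : C :=
  csum (slice_pole1 sigma t) n + csum (fun j => slice_pole2 t (n + j)) (N - n).

Lemma slice_coefficient_bounds (sigma : C) :
  sigma * sigma = - (3) ->
  (Cmod sigma <= 2 /\ Cmod (- (1 + 3 * sigma) / 2) <= 5 /\ Cmod ((sigma - 7) / 2) <= 5 /\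
   Cmod (1 + sigma) <= 5)%R.
Proof.
  intros Hs. assert (H : (Cmod sigma * Cmod sigma = 3)%R).
  { rewrite <- Cmod_mult, Hs, Cmod_opp, Cmod_R, Rabs_pos_eq; lra. }
  assert (H0 := Cmod_ge_0 sigma). assert (H2 : (Cmod sigma <= 2)%R) by nra.
  rewrite !Cmod_half, Cmod_opp.
  assert (T1 := Cmod_triangle 1 (3 * sigma)). assert (T2 := Cmod_triangle sigma (- (7))).
  assert (T3 := Cmod_triangle 1 sigma).
  rewrite Cmod_mult, (Cmod_R 3), Rabs_pos_eq in T1 by lra.
  rewrite Cmod_opp, Cmod_R, Rabs_pos_eq in T2 by lra.
  rewrite Cmod_1 in *. unfold Cminus. lra.
Qed.

(** The variable x is the constant coefficient of the cubic and a does not involve it. Each quartic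
    is therefore exactly affine in x, and the root sigma t splits off as a factor free of x. *)
Lemma slice_term_factor (sigma : C) (N n : nat) (t x : R) :
  sigma * sigma = - (3) -> (Rabs t <= 1 / 100)%R ->
  slice_term sigma N n t x = slice_term sigma N n t 0 *
    (cprod (fun j => 1 + x * slice_pole1 sigma t j) n *
     cprod (fun j => 1 + x * slice_pole2 t (n + j)) (N - n)).
Proof.
  intros Hs Ht. destruct (slice_coefficient_bounds sigma Hs) as (_ & B1 & B2 & B3).
  unfold slice_term, norm_term.
  set (a := (1 - (1 + sigma) * t) / 2).
  rewrite (cprod_ext (fun j => quartic ((1 + sigma) * t) ((sigma - 1) * t ^ 2) (x - sigma * t ^ 3)
      (sigma * t * x) (a + nC j) / hC j ^ 4)
    (fun j => quartic ((1 + sigma) * t) ((sigma - 1) * t ^ 2) (0 - sigma * t ^ 3)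
      (sigma * t * 0) (a + nC j) / hC j ^ 4 * (1 + x * slice_pole1 sigma t j))).
  2: { intros j _. unfold slice_pole1.
    assert (HD := cubic_lower_bound (/ hC j) _ _ _ t (Cmod_inv_hC j) B1 B2 B3 Ht).
    set (D := 1 + _ + _ + _) in *.
    assert (HD0 : D <> 0) by (intros E; rewrite E, Cmod_0 in HD; lra).
    assert (Hh := hC_neq0 j).
    replace (a + nC j) with (hC j - (1 + sigma) * t / 2) by (unfold a, hC; field).
    assert (E : (hC j - (1 + sigma) * t / 2) ^ 3 + t * (hC j - (1 + sigma) * t / 2) ^ 2
       - t ^ 2 * (hC j - (1 + sigma) * t / 2) = hC j ^ 3 * D).
    { unfold D. field [Hs]. exact Hh. }
    unfold quartic. set (y := hC j - _) in *.
    transitivity ((y + sigma * t) * (y ^ 3 + t * y ^ 2 - t ^ 2 * y + x) / hC j ^ 4).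
    { field. exact Hh. }
    transitivity ((y + sigma * t) * (y ^ 3 + t * y ^ 2 - t ^ 2 * y) / hC j ^ 4
        * (1 + x * ((/ hC j) ^ 3 * / D))).
    - rewrite E. field. split; assumption.
    - field. split; assumption. }
  rewrite (cprod_ext (fun j => quartic (- ((1 + sigma) * t)) ((sigma - 1) * t ^ 2)
      (- (x - sigma * t ^ 3)) (sigma * t * x) (nC (S (n + j))) / nC (S (n + j)) ^ 4)
    (fun j => quartic (- ((1 + sigma) * t)) ((sigma - 1) * t ^ 2) (- (0 - sigma * t ^ 3))
      (sigma * t * 0) (nC (S (n + j))) / nC (S (n + j)) ^ 4
       * (1 + x * slice_pole2 t (n + j)))).
  2: { intros j _. unfold slice_pole2.
    assert (B0 : (Cmod 0 <= 5)%R) by (rewrite Cmod_0; lra).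
    assert (B4 : (Cmod (- (1)) <= 5)%R) by (rewrite Cmod_opp, Cmod_1; lra).
    assert (HD := cubic_lower_bound (/ nC (S (n + j))) _ _ _ t (Cmod_inv_nC_S _) B4 B4 B0 Ht).
    set (D := 1 + _ + _ + _) in *.
    assert (HD0 : D <> 0) by (intros E; rewrite E, Cmod_0 in HD; lra).
    assert (Hh := nC_S_neq0 (n + j)). set (y := nC (S (n + j))) in *.
    assert (E : y ^ 3 - t * y ^ 2 - t ^ 2 * y = y ^ 3 * D).
    { unfold D. field. exact Hh. }
    unfold quartic.
    transitivity ((y - sigma * t) * (y ^ 3 - t * y ^ 2 - t ^ 2 * y - x) / y ^ 4).
    { field. exact Hh. }
    transitivity ((y - sigma * t) * (y ^ 3 - t * y ^ 2 - t ^ 2 * y) / y ^ 4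
        * (1 + x * (- (/ y) ^ 3 * / D))).
    - rewrite E. field. split; assumption.
    - field. split; assumption. }
  rewrite !cprod_mult. ring.
Qed.

(** Only sigma t is an explicit root, so the flip goes through the cubic of the other three. As
    sigma is imaginary, it leaves the real part of a untouched; as the cubic has real coefficients,
    its nonvanishing at positive integers is a real inequality. *)
Lemma slice_flip (sigma : C) (N : nat) (t x : R) :
  sigma * sigma = - (3) -> Re sigma = 0%R -> (Rabs t <= 1 / 100)%R -> (Rabs x <= 1 / 100)%R ->
  csum (fun n => RtoC (q n * rho N n) * slice_term sigma N n t x) (S N) =
  csum (fun n => RtoC (q n * rho N n) * slice_term (- sigma) N n t x) (S N).
Proof.
  intros Hs Hre Ht Hx.
  apply Rabs_le_between in Ht, Hx.
  assert (Hst : Re (sigma * t) = 0%R) by (simpl; fold (Re sigma); rewrite Hre; ring).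
  assert (H0 : forall (s : C) j, Re s = 0%R -> (1 - s - t) / 2 + nC j <> 0).
  { intros s j Hs0. apply neq0_of_Re_pos. assert (Hj := pos_INR j).
    unfold Cminus. rewrite Re_plus, Re_half, !Re_plus, !Re_opp, Re_nC, Hs0. simpl. lra. }
  unfold slice_term. apply norm_sum_eq_of_omega_eq.
  - intros j. replace (1 - (1 + sigma) * t) with (1 - sigma * t - t) by ring. now apply H0.
  - intros j. replace (1 - (1 + - sigma) * t) with (1 - - (sigma * t) - t) by ring.
    apply H0. rewrite Re_opp, Hst. ring.
  - assert (F := omega_flip N (sigma * t) t (- t ^ 2) x).
    replace ((1 + sigma) * t) with (sigma * t + t) by ring.
    replace ((sigma - 1) * t ^ 2) with (- t ^ 2 + sigma * t * t) by ring.
    replace (x - sigma * t ^ 3) with (x + sigma * t * (- t ^ 2)) by ring.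
    replace ((1 + - sigma) * t) with (- (sigma * t) + t) by ring.
    replace ((- sigma - 1) * t ^ 2) with (- t ^ 2 - sigma * t * t) by ring.
    replace (x - - sigma * t ^ 3) with (x - sigma * t * (- t ^ 2)) by ring.
    replace (- sigma * t * x) with (- (sigma * t) * x) by ring.
    apply F; intros j.
    + now apply H0.
    + replace (1 + sigma * t - t) with (1 - - (sigma * t) - t) by ring.
      apply H0. rewrite Re_opp, Hst. ring.
    + apply neq0_of_Re_pos. unfold Cminus. rewrite Re_plus, Re_opp, Hst, Re_nC, S_INR.
      assert (Hj := pos_INR j). lra.
    + apply neq0_of_Re_pos. rewrite Re_plus, Hst, Re_nC, S_INR.
      assert (Hj := pos_INR j). lra.
    + replace (cubic (- t) (- t ^ 2) (- x) (nC (S j))) with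
        (RtoC (INR (S j) ^ 3 - t * INR (S j) ^ 2 - t ^ 2 * INR (S j) - x)).
      * apply RtoC_neq0. rewrite S_INR. assert (Hj := pos_INR j).
        assert (t ^ 2 <= 1)%R by nra. set (u := INR j) in *.
        assert (0 <= u * u)%R by nra. assert (0 <= u * u * u)%R by nra.
        assert (t * (u + 1) ^ 2 <= 1 / 100 * (u + 1) ^ 2)%R by nra.
        assert (t ^ 2 * (u + 1) <= 1 / 100 * (u + 1))%R by nra.
        nra.
      * unfold cubic, nC. rewrite !RtoC_minus, !RtoC_mult, !RtoC_pow. ring.
Qed.

(** The flip is compared to first order in x at fixed t, before any expansion in t, so the
    remainders in x need no uniformity in t. *)
Lemma slice_linear_flip (sigma : C) (N : nat) (t : R) :
  sigma * sigma = - (3) -> Re sigma = 0%R -> (Rabs t <= 1 / 100)%R ->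
  csum (fun n => RtoC (q n * rho N n) *
     (slice_term sigma N n t 0 * slice_log_deriv sigma N n t)) (S N) =
  csum (fun n => RtoC (q n * rho N n) *
     (slice_term (- sigma) N n t 0 * slice_log_deriv (- sigma) N n t)) (S N).
Proof.
  intros Hs Hre Ht.
  assert (HL : forall s, s * s = - (3) -> exists r : R -> C, bounded_near0 r /\
    forall x : R, (Rabs x <= 1 / 100)%R ->
    csum (fun n => RtoC (q n * rho N n) * slice_term s N n t x) (S N) =
    csum (fun n => RtoC (q n * rho N n) * slice_term s N n t 0) (S N) +
    csum (fun n => RtoC (q n * rho N n) *
      (slice_term s N n t 0 * slice_log_deriv s N n t)) (S N) * x + x ^ 2 * r x).
  { intros s Hs'. generalize (S N). intros m. induction m as [|m IH].
    - exists (fun _ => 0). split; [bounded|]. intros; simpl; ring.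
    - destruct IH as (r & Hr & HE).
      destruct (jet1_mult _ _ _ _ (jet1_cprod (slice_pole1 s t) m)
        (jet1_cprod (fun j => slice_pole2 t (m + j)) (N - m))) as (r' & Hr' & HE').
      exists (fun x : R => r x + RtoC (q m * rho N m) * slice_term s N m t 0 * r' x).
      split; [bounded|]. intros x Hx.
      change (csum (fun n => RtoC (q n * rho N n) * slice_term s N n t x) m +
        RtoC (q m * rho N m) * slice_term s N m t x =
        (csum (fun n => RtoC (q n * rho N n) * slice_term s N n t 0) m +
         RtoC (q m * rho N m) * slice_term s N m t 0) +
        (csum (fun n => RtoC (q n * rho N n) *
            (slice_term s N n t 0 * slice_log_deriv s N n t)) m +
         RtoC (q m * rho N m) * (slice_term s N m t 0 * slice_log_deriv s N m t)) * x +
        x ^ 2 * (r x + RtoC (q m * rho N m) * slice_term s N m t 0 * r' x)).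
      rewrite HE, (slice_term_factor s N m t x), HE' by assumption.
      unfold slice_log_deriv. ring. }
  assert (Hs2 : - sigma * - sigma = - (3)) by (rewrite <- Hs; ring).
  destruct (HL sigma Hs) as (r & Hr & HE). destruct (HL (- sigma) Hs2) as (r' & Hr' & HE').
  set (c0 := csum (fun n => RtoC (q n * rho N n) * slice_term sigma N n t 0) (S N)) in *.
  set (c0' := csum (fun n => RtoC (q n * rho N n) * slice_term (- sigma) N n t 0) (S N)) in *.
  match goal with |- ?u = ?v => set (c1 := u) in *; set (c1' := v) in * end.
  assert (HF : forall x : R, (0 < x <= 1 / 100)%R ->
    (c0 - c0') + x * ((c1 - c1') + x * (r x - r' x)) = 0).
  { intros x Hx. assert (Ha : (Rabs x <= 1 / 100)%R) by (rewrite Rabs_pos_eq; lra).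
    assert (F := slice_flip sigma N t x Hs Hre Ht Ha).
    rewrite (HE x Ha), (HE' x Ha) in F.
    transitivity (c0 + c1 * x + x ^ 2 * r x - (c0' + c1' * x + x ^ 2 * r' x)); [ring|].
    rewrite F. ring. }
  destruct (eq0_of_affine_bounded (c0 - c0') (fun x : R => (c1 - c1') + x * (r x - r' x)))
    as [_ H1]; [bounded|exact HF|].
  destruct (eq0_of_affine_bounded (c1 - c1') (fun x : R => r x - r' x))
    as [H2 _]; [bounded|exact H1|].
  transitivity (c1 - c1' + c1'); [ring|rewrite H2; ring].
Qed.

Lemma csum_inv_hC_pow1 (n : nat) : csum (fun j => / hC j) n = half_harm 1 n.
Proof. rewrite <- csum_half_harm. apply csum_ext. intros; ring. Qed.

Lemma csum_inv_nC_pow1 (N n : nat) :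
  csum (fun j => / nC (S (n + j))) (N - n) = tail_harm 1 N n.
Proof. rewrite <- csum_tail_harm. apply csum_ext. intros; ring. Qed.

Lemma jet3_slice_term (sigma : C) (N n : nat) :
  sigma * sigma = - (3) ->
  jet3 (fun t : R => slice_term sigma N n t 0)
    (2 * theta sigma * fin_A N n) (- theta sigma ^ 2 * fin_R N n)
    (fin_K N n - sigma * fin_U3 N n).
Proof.
  intros Hs.
  set (th := theta sigma).
  assert (Hsig : sigma = - (1) - 2 * th) by (unfold th, theta; field).
  assert (Hth : th * th = - (1) - th).
  { unfold th, theta. field [Hs]. }
  assert (Hth3 : th ^ 3 = 1) by ring [Hth].
  assert (Hsb : (Cmod th <= 2)%R).
  { destruct (slice_coefficient_bounds sigma Hs) as (B & _).
    unfold th, theta. rewrite Cmod_half, Cmod_opp.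
    assert (T := Cmod_triangle 1 sigma). rewrite Cmod_1 in T. lra. }
  set (z := fun j => / hC j). set (z' := fun j => / nC (S (n + j))).
  assert (Hd : 1 + 4 * nC n <> 0).
  { apply neq0_of_Re_pos. assert (H := pos_INR n). simpl. lra. }
  set (d := 2 / (1 + 4 * nC n)).
  apply (jet3_ext (fun t : R => (1 + (th * d) * t) *
    (cprod (fun j => 1 + (th * z j) * t) n * cprod (fun j => 1 + (th * z j) * t) n) *
    cprod (fun j => 1 + (- th * z j) * t) (N - n) *
    cprod (fun j => / (1 + (th * z j) * t)) (S (N + n)) *
    cprod (fun j => 1 + (2 * th * z j) * t + (2 * th * z j) ^ 2 / 2 * t ^ 2
        + (2 - sigma) * z j ^ 3 * t ^ 3 + - (2) * z j ^ 4 * t ^ 4) n *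
    cprod (fun j => 1 + (2 * th * z' j) * t + (2 * th * z' j) ^ 2 / 2 * t ^ 2
        + sigma * z' j ^ 3 * t ^ 3 + 0 * t ^ 4) (N - n)) _
   (th * d + (csum (fun j => th * z j) n + csum (fun j => th * z j) n)
    + csum (fun j => - th * z j) (N - n) + csum (fun j => - (th * z j)) (S (N + n))
    + csum (fun j => 2 * th * z j) n + csum (fun j => 2 * th * z' j) (N - n))
   (- (th * d) ^ 2 / 2 + 
      (csum (fun j => - (th * z j) ^ 2 / 2) n + csum (fun j => - (th * z j) ^ 2 / 2) n)
    + csum (fun j => - (- th * z j) ^ 2 / 2) (N - n)
    + csum (fun j => (th * z j) ^ 2 / 2) (S (N + n))
    + csum (fun j => 0) n + csum (fun j => 0) (N - n))
   ((th * d) ^ 3 / 3 + (csum (fun j => (th * z j) ^ 3 / 3) n + csum (fun j => (th * z j) ^ 3 / 3) n)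
    + csum (fun j => (- th * z j) ^ 3 / 3) (N - n)
    + csum (fun j => - (th * z j) ^ 3 / 3) (S (N + n))
    + csum (fun j => (2 - sigma) * z j ^ 3 - (2 * th * z j) ^ 3 / 6) n
    + csum (fun j => sigma * z' j ^ 3 - (2 * th * z' j) ^ 3 / 6) (N - n))).
  - intros t Ht. unfold slice_term, norm_term.
    replace ((1 - (1 + sigma) * t) / 2) with (/ 2 + th * t) by (rewrite Hsig; field).
    assert (E1 : forall j, (/ 2 + th * t + nC j) / hC j = 1 + th * z j * t).
    { intros j. unfold z. replace (/ 2 + th * t + nC j) with (hC j + th * t)
        by (unfold hC; ring). field. apply hC_neq0. }
    assert (E2 : forall j, 1 + th * z j * t <> 0).
    { intros j E. assert (H := Cmod_1_plus_ge (th * z j * t)).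
      rewrite E, Cmod_0 in H. apply (Rlt_irrefl 0).
      apply Rlt_le_trans with (1 / 2)%R; [lra|]. apply H.
      rewrite !Cmod_mult, Cmod_R. unfold z. assert (Hz := Cmod_inv_hC j).
      apply Rle_trans with (4 * (1 / 100))%R; [|lra].
      apply Rmult_le_compat; auto using Rabs_pos.
      - apply Rmult_le_pos; apply Cmod_ge_0.
      - replace 4%R with (2 * 2)%R by ring. apply Rmult_le_compat; auto using Cmod_ge_0. }
    rewrite (cprod_ext (fun j => (/ 2 + th * t + nC j) / hC j) _ n (fun j _ => E1 j)).
    rewrite (cprod_ext (fun j => (1 - (/ 2 + th * t) + nC j) / hC j)
       (fun j => 1 + - th * z j * t)).
    2: { intros j _. unfold z. replace (1 - (/ 2 + th * t) + nC j) with (hC j - th * t)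
        by (unfold hC; field). field. apply hC_neq0. }
    rewrite (cprod_ext (fun j => hC j / (/ 2 + th * t + nC j))
       (fun j => / (1 + th * z j * t))).
    2: { intros j _. replace (/ 2 + th * t + nC j) with (hC j * (1 + th * z j * t)).
         - field. split; [apply E2|apply hC_neq0].
         - rewrite <- E1. field. apply hC_neq0. }
    (* Both the shifted roots theta t + y_i and the numbers -y_i have sum 2 theta t and squares
       summing to zero, so both quartics fall under [jet3_quartic]. *)
    rewrite (cprod_ext (fun j => quartic _ _ _ _ (/ 2 + th * t + nC j) / hC j ^ 4)
      (fun j => 1 + (2 * th * z j) * t + (2 * th * z j) ^ 2 / 2 * t ^ 2
        + (2 - sigma) * z j ^ 3 * t ^ 3 + - (2) * z j ^ 4 * t ^ 4)).
    2: { intros j _. replace (/ 2 + th * t + nC j) with (hC j + th * t)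
        by (unfold hC; ring). unfold quartic, z. rewrite Hsig. field [Hth]. apply hC_neq0. }
    rewrite (cprod_ext (fun j => quartic _ _ _ _ (nC (S (n + j))) / nC (S (n + j)) ^ 4)
      (fun j => 1 + (2 * th * z' j) * t + (2 * th * z' j) ^ 2 / 2 * t ^ 2
        + sigma * z' j ^ 3 * t ^ 3 + 0 * t ^ 4)).
    2: { intros j _. unfold quartic, z'. rewrite Hsig. field [Hth]. apply nC_S_neq0. }
    replace ((/ 2 + th * t + 2 * nC n) / (/ 2 + 2 * nC n)) with (1 + th * d * t).
    + ring.
    + unfold d. field. intros E. apply Hd. rewrite <- E. ring.
  - rewrite csum_opp, !csum_scal. unfold z, z'. rewrite !csum_inv_hC_pow1, csum_inv_nC_pow1.
    unfold fin_A, d.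
    replace (4 * INR n + 1)%R with (1 + 4 * INR n)%R by ring.
    assert (Hn := pos_INR n).
    rewrite RtoC_minus, !RtoC_plus, RtoC_div, RtoC_inv, !RtoC_plus, !RtoC_mult by lra.
    fold (nC n). field. exact Hd.
  - assert (E : forall m, csum (fun _ => 0) m = 0)
      by (intros m; induction m as [|m IH]; simpl; [|rewrite IH]; ring).
    assert (E1 : forall m, csum (fun j => - (th * z j) ^ 2 / 2) m = - th ^ 2 / 2 * half_harm 2 m).
    { intros m. rewrite <- csum_half_harm, <- csum_scal. apply csum_ext. intros j _.
      unfold z. field. apply hC_neq0. }
    rewrite !E, !E1.
    rewrite (csum_ext (fun j => - (- th * z j) ^ 2 / 2) (fun j => - (th * z j) ^ 2 / 2))
      by (intros; field).
    rewrite (csum_ext (fun j => (th * z j) ^ 2 / 2) (fun j => - (- (th * z j) ^ 2 / 2)))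
      by (intros; field).
    rewrite csum_opp, !E1. unfold fin_R, d.
    replace (4 * INR n + 1)%R with (1 + 4 * INR n)%R by ring.
    assert (Hn := pos_INR n).
    rewrite !RtoC_plus, !RtoC_div, RtoC_minus, RtoC_pow, !RtoC_plus, !RtoC_mult
      by first [lra|apply pow_nonzero; lra].
    fold (nC n). field. exact Hd.
  - assert (E1 : forall m, csum (fun j => (th * z j) ^ 3 / 3) m = / 3 * half_harm 3 m).
    { intros m. rewrite <- csum_half_harm, <- csum_scal. apply csum_ext. intros j _.
      unfold z. rewrite Cpow_mult_l, Hth3. field. apply hC_neq0. }
    rewrite (csum_ext (fun j => (- th * z j) ^ 3 / 3) (fun j => - ((th * z j) ^ 3 / 3)))
      by (intros; field).
    rewrite (csum_ext (fun j => - (th * z j) ^ 3 / 3) (fun j => - ((th * z j) ^ 3 / 3)))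
      by (intros; field).
    rewrite (csum_ext (fun j => (2 - sigma) * z j ^ 3 - (2 * th * z j) ^ 3 / 6)
      (fun j => (2 / 3 - sigma) * z j ^ 3)).
    2: { intros j _. transitivity ((2 - sigma) * z j ^ 3 - 4 / 3 * th ^ 3 * z j ^ 3); [field|].
         rewrite Hth3. field. }
    rewrite (csum_ext (fun j => sigma * z' j ^ 3 - (2 * th * z' j) ^ 3 / 6)
      (fun j => (sigma - 4 / 3) * z' j ^ 3)).
    2: { intros j _. transitivity (sigma * z' j ^ 3 - 4 / 3 * th ^ 3 * z' j ^ 3); [field|].
         rewrite Hth3. field. }
    rewrite !csum_opp, !E1, !csum_scal. unfold z, z'. rewrite csum_half_harm, csum_tail_harm.
    rewrite Cpow_mult_l, Hth3. unfold fin_K, fin_U3, d.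
    replace (4 * INR n + 1)%R with (1 + 4 * INR n)%R by ring.
    assert (Hn := pos_INR n).
    rewrite !RtoC_minus, !RtoC_plus, !RtoC_div, !RtoC_minus, !RtoC_plus, !RtoC_mult, RtoC_pow,
      !RtoC_div, !RtoC_plus, !RtoC_mult by lra.
    fold (nC n). field. exact Hd.
  - let m := (apply (jet3_mult (fun t : R => _) (fun t : R => _))) in
      m; [m; [m; [m; [m; [|m]|]|]|]|];
      try apply jet3_linear; apply (jet3_cprod (fun j t => _)); intros j _;
      try apply jet3_linear; try apply jet3_quartic.
    apply jet3_inv_linear. rewrite Cmod_mult. assert (H := Cmod_inv_hC j).
    replace 4%R with (2 * 2)%R by ring. apply Rmult_le_compat; auto using Cmod_ge_0.
Qed.

Lemma poly3_slice_log_deriv (sigma : C) (N n : nat) :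
  sigma * sigma = - (3) ->
  poly3 (slice_log_deriv sigma N n) (fin_U3 N n)
    (- fin_U4 N n - 3 * theta sigma * half_harm 4 n)
    (- 2 * fin_U5 N n + 2 * theta sigma ^ 2 * half_harm 5 n)
    (- 3 * (half_harm 6 n + tail_harm 6 N n)).
Proof.
  intros Hs. destruct (slice_coefficient_bounds sigma Hs) as (_ & B1 & B2 & B3).
  assert (B0 : (Cmod 0 <= 5)%R) by (rewrite Cmod_0; lra).
  assert (B4 : (Cmod (- (1)) <= 5)%R) by (rewrite Cmod_opp, Cmod_1; lra).
  set (th := theta sigma).
  assert (Hsig : sigma = - (1) - 2 * th) by (unfold th, theta; field).
  assert (Hth : th * th = - (1) - th) by (unfold th, theta; field [Hs]).
  apply (poly3_ext (slice_log_deriv sigma N n) _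
    (csum (fun j => (/ hC j) ^ 3) n + csum (fun j => - (1) * (/ nC (S (n + j))) ^ 3) (N - n))
    (csum (fun j => (- (1) - 3 * th) * (/ hC j) ^ 4) n +
       csum (fun j => - (1) * (/ nC (S (n + j))) ^ 4) (N - n))
    (csum (fun j => (2 * th ^ 2 - 2) * (/ hC j) ^ 5) n +
       csum (fun j => - (2) * (/ nC (S (n + j))) ^ 5) (N - n))
    (csum (fun j => - (3) * (/ hC j) ^ 6) n +
       csum (fun j => - (3) * (/ nC (S (n + j))) ^ 6) (N - n))).
  - reflexivity.
  - rewrite csum_scal, csum_half_harm, csum_tail_harm. unfold fin_U3. rewrite RtoC_minus. ring.
  - rewrite !csum_scal, csum_half_harm, csum_tail_harm. unfold fin_U4. rewrite RtoC_plus. ring.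
  - rewrite !csum_scal, csum_half_harm, csum_tail_harm. unfold fin_U5. rewrite RtoC_plus. ring.
  - rewrite !csum_scal, csum_half_harm, csum_tail_harm. ring.
  - apply (poly3_plus (fun t : R => csum (slice_pole1 sigma t) n)
      (fun t : R => csum (fun j => slice_pole2 t (n + j)) (N - n)));
      apply (poly3_csum (fun j t => _)); intros j _.
    + eapply poly3_ext; [reflexivity| | | | |
        exact (poly3_mult _ _ _ _ _ _ _ _ _ _ (poly3_const ((/ hC j) ^ 3))
          (poly3_inv_cubic (/ hC j) _ _ _ (Cmod_inv_hC j) B1 B2 B3))];
        rewrite ?Hsig; field [Hth]; apply hC_neq0.
    + eapply poly3_ext; [reflexivity| | | | |
        exact (poly3_mult _ _ _ _ _ _ _ _ _ _ (poly3_const (- (/ nC (S (n + j))) ^ 3))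
          (poly3_inv_cubic (/ nC (S (n + j))) _ _ _ (Cmod_inv_nC_S _) B4 B4 B0))];
        field; apply nC_S_neq0.
Qed.

Lemma finite_identity_p2_slice (N : nat) :
  rsum (fun n => q n * rho N n * (fin_X N n * fin_U4 N n - 2 * fin_A N n * fin_U5 N n
    + fin_U3 N n ^ 2))%R (S N) = 0%R.
Proof.
  set (sigma := RtoC (sqrt 3) * Ci).
  assert (Hs : sigma * sigma = - (3)).
  { unfold sigma. transitivity (RtoC (sqrt 3) * RtoC (sqrt 3) * (Ci * Ci)); [ring|].
    rewrite Ci_sqr, <- RtoC_mult, sqrt_sqrt by lra. ring. }
  assert (Hre : Re sigma = 0%R) by (simpl; ring).
  assert (Hs2 : - sigma * - sigma = - (3)) by (rewrite <- Hs; ring).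
  set (w := fun n => RtoC (q n * rho N n)).
  (* The t^3 coefficient of the product of the expansions in [jet3_slice_term] and
     [poly3_slice_log_deriv]. *)
  set (G := fun s n =>
    1 * (- 3 * (half_harm 6 n + tail_harm 6 N n))
    + 2 * theta s * fin_A N n * (- 2 * fin_U5 N n + 2 * theta s ^ 2 * half_harm 5 n)
    + (- theta s ^ 2 * fin_R N n + (2 * theta s * fin_A N n) ^ 2 / 2) *
      (- fin_U4 N n - 3 * theta s * half_harm 4 n)
    + (fin_K N n - s * fin_U3 N n + 2 * theta s * fin_A N n * (- theta s ^ 2 * fin_R N n)
       + (2 * theta s * fin_A N n) ^ 3 / 6) * fin_U3 N n).
  assert (HP : forall s, s * s = - (3) -> exists d0 d1 d2, poly3 (fun t : R =>
      csum (fun n => w n * (slice_term s N n t 0 * slice_log_deriv s N n t)) (S N))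
      d0 d1 d2 (csum (fun n => w n * G s n) (S N))).
  { intros s Hs'. do 3 eexists. apply (poly3_csum (fun n t => _)). intros n _.
    eapply poly3_ext; [reflexivity| | | | |
      exact (poly3_mult _ _ _ _ _ _ _ _ _ _ (poly3_const (w n))
        (poly3_mult _ _ _ _ _ _ _ _ _ _ (jet3_slice_term s N n Hs')
           (poly3_slice_log_deriv s N n Hs')))].
    - instantiate (1 := fun n => _). reflexivity.
    - instantiate (1 := fun n => _). reflexivity.
    - instantiate (1 := fun n => _). reflexivity.
    - unfold G. ring. }
  destruct (HP sigma Hs) as (d0 & d1 & d2 & P).
  destruct (HP (- sigma) Hs2) as (d0' & d1' & d2' & P').
  assert (E : csum (fun n => w n * G sigma n) (S N) = csum (fun n => w n * G (- sigma) n) (S N)).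
  { eapply poly3_coefficient_unique; [exact P|].
    eapply poly3_ext; [| | | | |exact P']; try reflexivity.
    intros t Ht. symmetry. apply slice_linear_flip; assumption. }
  apply (rsum_eq0_of_csum (fun n => q n * rho N n)%R _ (- (2) * sigma)
     (fun n => G sigma n - G (- sigma) n)).
  - apply Cmult_neq_0.
    + rewrite <- RtoC_opp. apply RtoC_neq0. lra.
    + intros H. rewrite H, Cmult_0_l in Hs. rewrite <- RtoC_opp in Hs. apply RtoC_inj in Hs. lra.
  (* Flipping sigma replaces theta by theta^2. Terms with theta^0 or theta^3 = 1 cancel in the
     difference, among them [fin_K], the sums of order 6 and the separate [half_harm 4] and
     [half_harm 5]. The rest survives through theta^2 - theta = sigma and through the explicit sigma
     in front of [fin_U3]. *)
  - intros n. unfold G, theta, fin_X.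
    rewrite !RtoC_plus, !RtoC_minus, !RtoC_mult, !RtoC_pow, RtoC_minus, !RtoC_mult, !RtoC_pow,
      RtoC_div by lra.
    field [Hs].
  - fold (w). transitivity (csum (fun n => w n * G sigma n - w n * G (- sigma) n) (S N)).
    + apply csum_ext. intros n _. unfold w. ring.
    + rewrite csum_minus, E. ring.
Qed.

Local Close Scope C_scope.

(** * Passage to the limit in triangular arrays *)

Lemma sum_n_rsum (f : nat -> R) (n : nat) : sum_n f n = rsum f (S n).
Proof.
  induction n as [|n IH].
  - rewrite sum_O. simpl. ring.
  - rewrite sum_Sn, IH. reflexivity.
Qed.

Lemma rsum_minus_le (f B : nat -> R) (m k : nat) :
  (forall n, (n < m + k)%nat -> Rabs (f n) <= B n) ->
  Rabs (rsum f (m + k) - rsum f m) <= rsum B (m + k) - rsum B m.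
Proof.
  induction k as [|k IH]; intros H.
  - rewrite Nat.add_0_r, !Rminus_diag, Rabs_R0. lra.
  - rewrite Nat.add_succ_r. simpl.
    replace (rsum f (m + k) + f (m + k)%nat - rsum f m) with
      (rsum f (m + k) - rsum f m + f (m + k)%nat) by ring.
    apply Rle_trans with (1 := Rabs_triang _ _).
    assert (H1 := H (m + k)%nat ltac:(lia)).
    assert (H2 : Rabs (rsum f (m + k) - rsum f m) <= rsum B (m + k) - rsum B m)
      by (apply IH; intros; apply H; lia).
    lra.
Qed.

Lemma rsum_le (f g : nat -> R) (n : nat) :
  (forall k, (k < n)%nat -> f k <= g k) -> rsum f n <= rsum g n.
Proof.
  induction n as [|n IH]; intros H; simpl; [lra|].
  apply Rplus_le_compat; auto with arith.
Qed.

Lemma rsum_ge0 (f : nat -> R) (n : nat) : (forall k, 0 <= f k) -> 0 <= rsum f n.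
Proof. intros H. induction n as [|n IH]; simpl; [lra|]. specialize (H n). lra. Qed.

Lemma rsum_add (f : nat -> R) (m n : nat) :
  rsum f (m + n) = rsum f m + rsum (fun j => f (m + j)%nat) n.
Proof.
  induction n as [|n IH]; [rewrite Nat.add_0_r; simpl; ring|].
  rewrite Nat.add_succ_r. simpl. rewrite IH. ring.
Qed.

Lemma ex_series_bounded_ge0 (f : nat -> R) (M : R) :
  (forall n, 0 <= f n) -> (forall n, rsum f n <= M) -> ex_series f.
Proof.
  intros H0 HM.
  destruct (ex_finite_lim_seq_incr (sum_n f) M) as [l Hl].
  - intros n. rewrite sum_Sn. unfold plus; simpl. specialize (H0 (S n)). lra.
  - intros n. rewrite sum_n_rsum. apply HM.
  - now exists l.
Qed.

(* Tannery's theorem, for triangular arrays whose rows sum to zero. *)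
Lemma tannery_zero (f : nat -> nat -> R) (g B : nat -> R) :
  ex_series B ->
  (forall N n, (n <= N)%nat -> Rabs (f N n) <= B n) ->
  (forall n, is_lim_seq (fun N => f N n) (g n)) ->
  (forall N, rsum (f N) (S N) = 0) ->
  is_series g 0.
Proof.
  intros HB Hf Hg H0.
  assert (HBpos : forall n, 0 <= B n)
    by (intros n; apply Rle_trans with (2 := Hf n n (Nat.le_refl n)), Rabs_pos).
  assert (Hsum := Series_correct _ HB).
  assert (HBle : forall n, rsum B n <= Series B).
  { intros n. apply Rle_trans with (rsum B (S n)); [simpl; specialize (HBpos n); lra|].
    rewrite <- sum_n_rsum. apply is_lim_seq_incr_compare; [exact Hsum|].
    intros k. rewrite sum_Sn. unfold plus; simpl. specialize (HBpos (S k)). lra. }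
  assert (Hlim : forall m, is_lim_seq (fun N => rsum (f N) m) (rsum g m)).
  { induction m as [|m IH]; simpl; [apply is_lim_seq_const|].
    apply is_lim_seq_plus' with (1 := IH), Hg. }
  assert (Hle : forall m, Rabs (sum_n g m) <= Series B - sum_n B m).
  { intros m. rewrite !sum_n_rsum.
    assert (HA := is_lim_seq_abs _ _ (Hlim (S m))).
    apply (is_lim_seq_le_loc (fun N => Rabs (rsum (f N) (S m)))
             (fun _ => Series B - rsum B (S m))
             (Rabs (rsum g (S m))) (Series B - rsum B (S m)));
      [|exact HA|apply is_lim_seq_const].
    exists m. intros N HN.
    destruct (Nat.le_exists_sub m N HN) as [k [-> _]].
    (* As the row sums to zero, its head up to m is minus its tail, which the tail of [B] bounds
       uniformly in the row. *)
    replace (rsum (f (k + m)%nat) (S m)) with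
      (- (rsum (f (k + m)%nat) (S m + k) - rsum (f (k + m)%nat) (S m))).
    - rewrite Rabs_Ropp. apply Rle_trans with (rsum B (S m + k) - rsum B (S m)).
      + apply rsum_minus_le. intros n Hn. apply Hf. lia.
      + specialize (HBle (S m + k)%nat). lra.
    - replace (S m + k)%nat with (S (k + m)) by lia. rewrite H0. ring. }
  change (is_lim_seq (sum_n g) 0).
  apply is_lim_seq_abs_0.
  apply is_lim_seq_le_le with (u := fun _ => 0) (w := fun m => Series B - sum_n B m).
  - intros m. split; [apply Rabs_pos|apply Hle].
  - apply is_lim_seq_const.
  - replace (Finite 0) with (Finite (Series B - Series B)) by (f_equal; ring).
    apply is_lim_seq_minus'; [apply is_lim_seq_const|exact Hsum].
Qed.

(** * Bounds for the weights and a summable majorant *)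

Lemma ln_le_sub1 (y : R) : 0 < y -> ln y <= y - 1.
Proof. intros Hy. assert (H := exp_ineq1_le (ln y)). rewrite exp_ln in H; lra. Qed.

Lemma ln_step (x : R) : 0 < x -> / (x + 1) <= ln (x + 1) - ln x <= / x.
Proof.
  intros Hx.
  assert (H1 := ln_le_sub1 (x / (x + 1)) ltac:(apply Rdiv_lt_0_compat; lra)).
  assert (H2 := ln_le_sub1 ((x + 1) / x) ltac:(apply Rdiv_lt_0_compat; lra)).
  rewrite ln_div in H1, H2 by lra.
  replace (x / (x + 1) - 1) with (- / (x + 1)) in H1 by (field; lra).
  replace ((x + 1) / x - 1) with (/ x) in H2 by (field; lra).
  lra.
Qed.

Lemma ex_series_Rpower : ex_series (fun n => Rpower (INR n + 1) (- (5 / 4))).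
Proof.
  apply ex_series_bounded_ge0 with 5.
  - intros n. apply Rlt_le, exp_pos.
  (* The bound is 1 plus the integral of x^(-5/4) from 1 to n + 1. *)
  - assert (H : forall n, rsum (fun n => Rpower (INR n + 1) (- (5 / 4))) (S n)
                          <= 5 - 4 * Rpower (INR n + 1) (- (1 / 4))).
    { induction n as [|n IH].
      - simpl. unfold Rpower. rewrite !Rplus_0_l, ln_1, !Rmult_0_r, exp_0. lra.
      - change (rsum (fun n => Rpower (INR n + 1) (- (5 / 4))) (S n) +
          Rpower (INR (S n) + 1) (- (5 / 4)) <= 5 - 4 * Rpower (INR (S n) + 1) (- (1 / 4))).
        rewrite S_INR. set (x := INR n + 1) in *.
        assert (Hx : 0 < x) by (unfold x; assert (Hn := pos_INR n); lra).
        assert (HL := ln_step x Hx).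
        replace (Rpower (x + 1) (- (5 / 4))) with (Rpower (x + 1) (- (1 / 4)) * / (x + 1)).
        2: { replace (- (5 / 4)) with (- (1 / 4) + - (1)) by field.
             rewrite Rpower_plus, (Rpower_Ropp _ 1), Rpower_1; lra. }
        assert (Hv : Rpower (x + 1) (- (1 / 4)) * (1 + 1 / 4 * / (x + 1)) <= Rpower x (- (1 / 4))).
        { replace (Rpower x (- (1 / 4))) with
            (Rpower (x + 1) (- (1 / 4)) * exp (1 / 4 * (ln (x + 1) - ln x))).
          - apply Rmult_le_compat_l; [apply Rlt_le, exp_pos|].
            apply Rle_trans with (2 := exp_ineq1_le _). lra.
          - unfold Rpower. rewrite <- exp_plus. f_equal. field. }
        lra. }
    intros n. destruct n as [|n]; [simpl; lra|].
    assert (H1 := H n). assert (H2 : 0 < Rpower (INR n + 1) (- (1 / 4))) by apply exp_pos.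
    lra.
Qed.

(** The true order is 1 / (pi m). The upper bound controls q_n; the lower one is needed for the
    denominator of [rho]. *)
Lemma central_sqr_bounds (m : nat) :
  / (4 * INR m + 1) <= central m ^ 2 <= / (2 * INR m + 1).
Proof.
  induction m as [|m IH].
  - unfold central, Binomial.C. simpl. lra.
  - assert (Hm := pos_INR m). rewrite central_S, S_INR, Rpow_mult_distr.
    set (x := INR m) in *. set (y := (/ 2 + x) / (x + 1)).
    assert (Hy : 0 < y) by (apply Rdiv_lt_0_compat; lra).
    assert (Hy2 : 0 < y ^ 2) by (apply pow_lt; exact Hy).
    split.
    + apply Rle_trans with (/ (4 * x + 1) * y ^ 2); [|apply Rmult_le_compat_r; lra].
      unfold y. apply Rmult_le_reg_r with ((4 * x + 1) * (x + 1) ^ 2 * (4 * (x + 1) + 1)).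
      { repeat apply Rmult_lt_0_compat; try apply pow_lt; lra. }
      replace (/ (4 * x + 1) * ((/ 2 + x) / (x + 1)) ^ 2 *
        ((4 * x + 1) * (x + 1) ^ 2 * (4 * (x + 1) + 1)))
        with ((/ 2 + x) ^ 2 * (4 * (x + 1) + 1)) by (field; lra).
      replace (/ (4 * (x + 1) + 1) * ((4 * x + 1) * (x + 1) ^ 2 * (4 * (x + 1) + 1)))
        with ((4 * x + 1) * (x + 1) ^ 2) by (field; lra).
      nra.
    + apply Rle_trans with (/ (2 * x + 1) * y ^ 2); [apply Rmult_le_compat_r; lra|].
      unfold y. apply Rmult_le_reg_r with ((2 * x + 1) * (x + 1) ^ 2 * (2 * (x + 1) + 1)).
      { repeat apply Rmult_lt_0_compat; try apply pow_lt; lra. }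
      replace (/ (2 * x + 1) * ((/ 2 + x) / (x + 1)) ^ 2 *
        ((2 * x + 1) * (x + 1) ^ 2 * (2 * (x + 1) + 1)))
        with ((/ 2 + x) ^ 2 * (2 * (x + 1) + 1)) by (field; lra).
      replace (/ (2 * (x + 1) + 1) * ((2 * x + 1) * (x + 1) ^ 2 * (2 * (x + 1) + 1)))
        with ((2 * x + 1) * (x + 1) ^ 2) by (field; lra).
      nra.
Qed.

Lemma rho_ge0 (N n : nat) : 0 <= rho N n.
Proof.
  unfold rho. assert (H1 := pos_INR N). assert (H2 := pos_INR n).
  assert (H3 := central_pos (N - n)). assert (H4 := central_pos (N + n)).
  apply Rlt_le, Rdiv_lt_0_compat; apply Rmult_lt_0_compat; lra.
Qed.

(** Growth in n cannot be avoided: for n = N the factor [central (2n)] in the denominator makes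
    [rho] of order sqrt n. *)
Lemma rho_sqr_le (N n : nat) : (n <= N)%nat -> rho N n ^ 2 <= 2 * (INR n + 1).
Proof.
  intros HnN. destruct (Nat.le_exists_sub n N HnN) as [r [-> _]].
  unfold rho. replace (r + n - n)%nat with r by lia.
  assert (Hc := central_sqr_bounds r). assert (Hd := central_sqr_bounds (r + n + n)).
  assert (Pc := central_pos r). assert (Pd := central_pos (r + n + n)).
  rewrite !plus_INR in *. assert (Hx := pos_INR n). assert (Hy := pos_INR r).
  set (x := INR n) in *. set (y := INR r) in *.
  set (c := central r) in *. set (d := central (r + n + n)) in *.
  assert (Hd2 : / d ^ 2 <= 4 * (y + x + x) + 1).
  { rewrite <- (Rinv_inv (4 * (y + x + x) + 1)). apply Rinv_le_contravar; [|lra].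
    apply Rinv_0_lt_compat. lra. }
  replace (((2 * (y + x) + 1) * c / ((2 * (y + x) + 2 * x + 1) * d)) ^ 2) with
    ((2 * (y + x) + 1) ^ 2 / (2 * (y + x) + 2 * x + 1) ^ 2 * (c ^ 2 * / d ^ 2))
    by (field; split; lra).
  apply Rle_trans with ((2 * (y + x) + 1) ^ 2 / (2 * (y + x) + 2 * x + 1) ^ 2 *
    (/ (2 * y + 1) * (4 * (y + x + x) + 1))).
  - apply Rmult_le_compat_l.
    + apply Rlt_le, Rdiv_lt_0_compat; apply pow_lt; lra.
    + apply Rmult_le_compat; try lra; [apply pow2_ge_0|].
      apply Rlt_le, Rinv_0_lt_compat, pow_lt. exact Pd.
  - set (s := 2 * y + 1). replace (2 * (y + x) + 1) with (s + 2 * x) by (unfold s; ring).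
    replace (2 * (y + x) + 2 * x + 1) with (s + 4 * x) by (unfold s; ring).
    assert (Hs : 1 <= s) by (unfold s; lra).
    apply Rle_trans with ((s + 2 * x) ^ 2 / (s + 4 * x) ^ 2 * (/ s * (2 * (s + 4 * x)))).
    + apply Rmult_le_compat_l.
      * apply Rlt_le, Rdiv_lt_0_compat; apply pow_lt; lra.
      * apply Rmult_le_compat_l; [apply Rlt_le, Rinv_0_lt_compat; lra|unfold s; lra].
    + replace ((s + 2 * x) ^ 2 / (s + 4 * x) ^ 2 * (/ s * (2 * (s + 4 * x)))) with
        (2 * ((s + 2 * x) ^ 2 / ((s + 4 * x) * s))) by (field; lra).
      apply Rmult_le_compat_l; [lra|].
      apply Rmult_le_reg_r with ((s + 4 * x) * s); [apply Rmult_lt_0_compat; lra|].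
      replace ((s + 2 * x) ^ 2 / ((s + 4 * x) * s) * ((s + 4 * x) * s)) with ((s + 2 * x) ^ 2)
        by (field; lra).
      assert (0 <= x * (s * s - 1)) by (apply Rmult_le_pos; nra).
      assert (0 <= x * x * (s - 1)) by (apply Rmult_le_pos; nra).
      nra.
Qed.

Lemma q_bounds (n : nat) : 0 <= q n <= 2 * / (INR n + 1) ^ 2.
Proof.
  rewrite q_central. assert (Hc := central_sqr_bounds n). assert (Hn := pos_INR n).
  set (x := INR n) in *. set (c := central n) in *.
  assert (H0 : 0 <= c ^ 2) by apply pow2_ge_0.
  replace (c ^ 6) with ((c ^ 2) ^ 3) by ring.
  split; [apply Rmult_le_pos; [lra|now apply pow_le]|].
  assert (H3 : (c ^ 2) ^ 3 <= (/ (2 * x + 1)) ^ 3) by (apply pow_incr; lra).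
  apply Rle_trans with ((4 * x + 1) * (/ (2 * x + 1)) ^ 3); [apply Rmult_le_compat_l; lra|].
  apply Rle_trans with (2 * / (2 * x + 1) ^ 2).
  - replace ((4 * x + 1) * (/ (2 * x + 1)) ^ 3) with
      (((4 * x + 1) / (2 * x + 1)) * / (2 * x + 1) ^ 2) by (field; lra).
    apply Rmult_le_compat_r; [apply Rlt_le, Rinv_0_lt_compat, pow_lt; lra|].
    apply Rmult_le_reg_r with (2 * x + 1); [lra|].
    unfold Rdiv. rewrite Rmult_assoc, Rinv_l by lra. lra.
  - apply Rmult_le_compat_l; [lra|]. apply Rinv_le_contravar; [apply pow_lt; lra|].
    apply pow_incr; lra.
Qed.

Lemma q_rho_le (N n : nat) :
  (n <= N)%nat -> Rabs (q n * rho N n) <= 3 * Rpower (INR n + 1) (- (3 / 2)).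
Proof.
  intros HnN. assert (Hq := q_bounds n). assert (Hr := rho_ge0 N n).
  assert (Hr2 := rho_sqr_le N n HnN). assert (Hn := pos_INR n).
  set (u := INR n + 1) in *. assert (Hu : 0 < u) by (unfold u; lra).
  rewrite Rabs_pos_eq by (apply Rmult_le_pos; lra).
  assert (Hs : rho N n <= 3 / 2 * sqrt u).
  { apply Rsqr_incr_0_var; [|apply Rmult_le_pos; [lra|apply sqrt_pos]].
    unfold Rsqr.
    replace (3 / 2 * sqrt u * (3 / 2 * sqrt u)) with (9 / 4 * (sqrt u * sqrt u)) by field.
    rewrite sqrt_sqrt by lra. replace (rho N n * rho N n) with (rho N n ^ 2) by ring. lra. }
  apply Rle_trans with (2 * / u ^ 2 * (3 / 2 * sqrt u)).
  - apply Rmult_le_compat; lra.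
  - rewrite <- Rpower_sqrt by exact Hu. replace (- (3 / 2)) with (/ 2 + - (2)) by field.
    assert (E : Rpower u 2 = u ^ 2) by (rewrite <- Rpower_pow by exact Hu; f_equal; simpl; ring).
    rewrite Rpower_plus, (Rpower_Ropp _ 2), E. apply Req_le. field. lra.
Qed.

(** A small power that dominates the logarithm. The exponent 1/8 lets two such factors turn the
    majorant's exponent -3/2 into -5/4, still below -1. *)
Definition pw (n : nat) : R := Rpower (INR n + 1) (1 / 8).

Lemma ln_le_pw (n : nat) : ln (INR n + 1) <= 8 * (pw n - 1).
Proof.
  assert (H := exp_ineq1_le (1 / 8 * ln (INR n + 1))). unfold pw, Rpower. lra.
Qed.

Lemma pw_ge1 (n : nat) : 1 <= pw n.
Proof.
  assert (H := ln_le_pw n). assert (Hn := pos_INR n).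
  assert (0 <= ln (INR n + 1)) by (rewrite <- ln_1; apply ln_le; lra). lra.
Qed.

(** * Growth of the coefficients, uniform in N *)

Lemma half_harm_S (k n : nat) : half_harm k (S n) = half_harm k n + / (/ 2 + INR n) ^ k.
Proof. reflexivity. Qed.

Lemma half_harm_term_pos (k j : nat) : 0 < / (/ 2 + INR j) ^ k.
Proof. apply Rinv_0_lt_compat, pow_lt. assert (H := pos_INR j). lra. Qed.

Lemma half_harm_add (k m n : nat) :
  half_harm k (m + n) = half_harm k m + rsum (fun j => / (/ 2 + INR (m + j)) ^ k) n.
Proof. apply rsum_add. Qed.

Lemma half_harm_ge0 (k n : nat) : 0 <= half_harm k n.
Proof. apply rsum_ge0. intros j. apply Rlt_le, half_harm_term_pos. Qed.

Lemma half_harm_incr (k m n : nat) : (m <= n)%nat -> half_harm k m <= half_harm k n.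
Proof.
  intros H. destruct (Nat.le_exists_sub m n H) as [r [-> _]].
  rewrite Nat.add_comm, half_harm_add.
  assert (H0 : 0 <= rsum (fun j => / (/ 2 + INR (m + j)) ^ k) r)
    by (apply rsum_ge0; intros j; apply Rlt_le, half_harm_term_pos).
  lra.
Qed.

Lemma half_harm_subadd (k m n : nat) : half_harm k (m + n) <= half_harm k m + half_harm k n.
Proof.
  rewrite half_harm_add. apply Rplus_le_compat_l, rsum_le. intros j _.
  assert (H := pos_INR j). assert (H' := pos_INR m).
  apply Rinv_le_contravar; [apply pow_lt; lra|]. apply pow_incr. rewrite plus_INR. lra.
Qed.

Lemma half_harm1_le (n : nat) : half_harm 1 (S n) <= 8 * pw n.
Proof.
  assert (H : half_harm 1 (S n) <= 2 + (ln (INR n + / 2) - ln (/ 2))).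
  { induction n as [|n IH].
    - unfold half_harm. simpl. rewrite !Rplus_0_l, Rplus_0_r, Rmult_1_r, Rinv_inv. lra.
    - rewrite half_harm_S. assert (Hn := pos_INR n).
      assert (L := ln_step (INR n + / 2) ltac:(lra)).
      rewrite S_INR, pow_1. replace (/ 2 + (INR n + 1)) with (INR n + / 2 + 1) by ring.
      replace (INR n + 1 + / 2) with (INR n + / 2 + 1) by ring. lra. }
  assert (Hn := pos_INR n). assert (Hp := ln_le_pw n).
  assert (H1 : ln (INR n + / 2) <= ln (INR n + 1)) by (apply ln_le; lra).
  assert (H2 : - ln (/ 2) <= 1).
  { rewrite ln_Rinv by lra. assert (H3 := ln_le_sub1 2 ltac:(lra)). lra. }
  lra.
Qed.

Lemma tail_harm_bounds1 (N n : nat) : (n <= N)%nat ->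
  half_harm 1 (S N) - half_harm 1 (S n) <= tail_harm 1 N n <= half_harm 1 N - half_harm 1 n.
Proof.
  intros H. destruct (Nat.le_exists_sub n N H) as [r [-> _]].
  unfold tail_harm. replace (r + n - n)%nat with r by lia.
  replace (r + n)%nat with (n + r)%nat by lia.
  change (S (n + r)) with (S n + r)%nat. rewrite !half_harm_add. split.
  - apply Rle_trans with (rsum (fun j => / (/ 2 + INR (S n + j)) ^ 1) r); [lra|].
    apply rsum_le. intros j _. rewrite !pow_1. assert (Hj := pos_INR (n + j)).
    change (S n + j)%nat with (S (n + j)). apply Rinv_le_contravar; rewrite S_INR; lra.
  - apply Rle_trans with (rsum (fun j => / (/ 2 + INR (n + j)) ^ 1) r); [|lra].
    apply rsum_le. intros j _. rewrite !pow_1. assert (Hj := pos_INR (n + j)).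
    apply Rinv_le_contravar; rewrite ?S_INR; lra.
Qed.

(** Monotonicity and subadditivity compare every sum of length about N with [half_harm 1 N], whose
    contributions cancel. What remains are sums of length at most n + 1, of logarithmic size in
    n. *)
Lemma fin_A_bound (N n : nat) : (n <= N)%nat -> Rabs (fin_A N n) <= 33 * pw n.
Proof.
  intros H. assert (T := tail_harm_bounds1 N n H). unfold fin_A.
  assert (H1 := half_harm_subadd 1 (N - n) n). replace (N - n + n)%nat with N in H1 by lia.
  assert (H2 := half_harm_subadd 1 N (S n)). rewrite Nat.add_succ_r in H2.
  assert (H3 := half_harm_incr 1 (N - n) N ltac:(lia)).
  assert (H4 := half_harm_incr 1 N (S (N + n)) ltac:(lia)).
  assert (H5 := half_harm_incr 1 n (S n) ltac:(lia)).
  assert (H6 := half_harm_incr 1 N (S N) ltac:(lia)).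
  assert (H7 := half_harm1_le n). assert (H8 := pw_ge1 n). assert (H9 := half_harm_ge0 1 n).
  assert (Hn := pos_INR n).
  assert (H10 : 0 < / (4 * INR n + 1) <= 1).
  { split; [apply Rinv_0_lt_compat; lra|]. rewrite <- Rinv_1 at 2.
    apply Rinv_le_contravar; lra. }
  apply Rabs_le. lra.
Qed.

Lemma half_harm2_le (n : nat) : half_harm 2 n <= 6.
Proof.
  assert (H : forall n, half_harm 2 (S n) <= 6 - / (/ 2 + INR n)).
  { induction n0 as [|m IH].
    - unfold half_harm. simpl. rewrite Rplus_0_r. replace (/ / 2) with 2 by field.
      replace (/ (/ 2 * (/ 2 * 1))) with 4 by field. lra.
    - rewrite half_harm_S. assert (Hm := pos_INR m). rewrite S_INR.
      set (x := / 2 + INR m) in *. assert (Hx : 0 < x) by (unfold x; lra).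
      replace (/ 2 + (INR m + 1)) with (x + 1) by (unfold x; ring).
      assert (E : / x - / (x + 1) = / (x * (x + 1))) by (field; lra).
      assert (E2 : / (x + 1) ^ 2 <= / (x * (x + 1))).
      { apply Rinv_le_contravar; [apply Rmult_lt_0_compat; lra|]. nra. }
      lra. }
  destruct n as [|n]; [unfold half_harm; simpl; lra|].
  assert (H1 := H n). assert (H2 : 0 < / (/ 2 + INR n)).
  { apply Rinv_0_lt_compat. assert (Hn := pos_INR n). lra. }
  lra.
Qed.

Lemma half_harm_bound (k n : nat) : half_harm (S (S k)) n <= 2 ^ k * 6.
Proof.
  apply Rle_trans with (2 ^ k * half_harm 2 n).
  - induction n as [|n IH]; [unfold half_harm; simpl; lra|].
    rewrite !half_harm_S, Rmult_plus_distr_l. apply Rplus_le_compat; [exact IH|].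
    assert (Hn := pos_INR n). set (x := / 2 + INR n).
    assert (Hx : / 2 <= x) by (unfold x; lra).
    replace (S (S k)) with (k + 2)%nat by lia. rewrite pow_add, Rinv_mult.
    apply Rmult_le_compat_r; [apply Rlt_le, Rinv_0_lt_compat, pow_lt; lra|].
    rewrite <- pow_inv. apply pow_incr. split; [apply Rlt_le, Rinv_0_lt_compat; lra|].
    rewrite <- (Rinv_inv 2). apply Rinv_le_contravar; lra.
  - apply Rmult_le_compat_l; [apply pow_le; lra|apply half_harm2_le].
Qed.

Lemma tail_harm_ge0 (k N n : nat) : 0 <= tail_harm k N n.
Proof.
  apply rsum_ge0. intros j. apply Rlt_le, Rinv_0_lt_compat, pow_lt.
  rewrite S_INR. assert (H := pos_INR (n + j)). lra.
Qed.

Lemma tail_harm_le (k N n : nat) : tail_harm k N n <= half_harm k (N - n).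
Proof.
  apply rsum_le. intros j _. assert (H := pos_INR j). assert (H' := pos_INR n).
  apply Rinv_le_contravar; [apply pow_lt; lra|]. apply pow_incr.
  rewrite S_INR, plus_INR. lra.
Qed.

(** The constant is uniform in N, as domination requires; k counts the logarithmic factors, that is,
    the powers of [fin_A]. *)
Definition growth (k : nat) (f : nat -> nat -> R) : Prop :=
  exists C, 0 <= C /\ forall N n, (n <= N)%nat -> Rabs (f N n) <= C * pw n ^ k.

Lemma growth_weaken (k l : nat) (f : nat -> nat -> R) :
  (k <= l)%nat -> growth k f -> growth l f.
Proof.
  intros H (C & HC & Hf). exists C. split; [exact HC|]. intros N n Hn.
  apply Rle_trans with (1 := Hf N n Hn). apply Rmult_le_compat_l; [exact HC|].
  apply Rle_pow; [apply pw_ge1|exact H].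
Qed.

Lemma growth_plus (k : nat) (f g : nat -> nat -> R) :
  growth k f -> growth k g -> growth k (fun N n => f N n + g N n).
Proof.
  intros (C & HC & Hf) (D & HD & Hg). exists (C + D). split; [lra|]. intros N n Hn.
  apply Rle_trans with (1 := Rabs_triang _ _).
  specialize (Hf N n Hn). specialize (Hg N n Hn). lra.
Qed.

Lemma growth_mult (k l : nat) (f g : nat -> nat -> R) :
  growth k f -> growth l g -> growth (k + l) (fun N n => f N n * g N n).
Proof.
  intros (C & HC & Hf) (D & HD & Hg). exists (C * D). split; [now apply Rmult_le_pos|].
  intros N n Hn. rewrite Rabs_mult, pow_add.
  replace (C * D * (pw n ^ k * pw n ^ l)) with (C * pw n ^ k * (D * pw n ^ l)) by ring.
  apply Rmult_le_compat; auto using Rabs_pos.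
Qed.

Lemma growth_const (c : R) : growth 0 (fun _ _ => c).
Proof. exists (Rabs c). split; [apply Rabs_pos|]. intros. simpl. lra. Qed.

Lemma growth_scal (k : nat) (c : R) (f : nat -> nat -> R) :
  growth k f -> growth k (fun N n => c * f N n).
Proof. apply (growth_mult 0 k), growth_const. Qed.

Lemma growth_minus (k : nat) (f g : nat -> nat -> R) :
  growth k f -> growth k g -> growth k (fun N n => f N n - g N n).
Proof.
  intros Hf (D & HD & Hg). apply growth_plus; [exact Hf|].
  exists D. split; [exact HD|]. intros N n Hn. rewrite Rabs_Ropp. auto.
Qed.

Lemma growth_half_harm (k : nat) (u : nat -> nat -> nat) :
  growth 0 (fun N n => half_harm (S (S k)) (u N n)).
Proof.
  exists (2 ^ k * 6). split; [apply Rmult_le_pos; [apply pow_le|]; lra|]. intros N n _.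
  rewrite Rabs_pos_eq by apply half_harm_ge0. simpl. rewrite Rmult_1_r. apply half_harm_bound.
Qed.

Lemma growth_tail_harm (k : nat) : growth 0 (tail_harm (S (S k))).
Proof.
  exists (2 ^ k * 6). split; [apply Rmult_le_pos; [apply pow_le|]; lra|]. intros N n _.
  rewrite Rabs_pos_eq by apply tail_harm_ge0. simpl. rewrite Rmult_1_r.
  apply Rle_trans with (1 := tail_harm_le _ _ _), half_harm_bound.
Qed.

Lemma growth_fin_A : growth 1 fin_A.
Proof. exists 33. split; [lra|]. intros N n Hn. rewrite pow_1. now apply fin_A_bound. Qed.

Lemma growth_fin_R : growth 0 fin_R.
Proof.
  unfold fin_R. repeat apply growth_plus.
  - exists 2. split; [lra|]. intros N n _. assert (Hn := pos_INR n). simpl pow. rewrite !Rmult_1_r.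
    assert (H : 1 <= (4 * INR n + 1) * (4 * INR n + 1)) by nra.
    rewrite Rabs_pos_eq by (apply Rlt_le, Rdiv_lt_0_compat; lra).
    apply Rmult_le_reg_r with ((4 * INR n + 1) * (4 * INR n + 1)); [lra|].
    unfold Rdiv. rewrite Rmult_assoc, Rinv_l; lra.
  - apply (growth_half_harm 0 (fun _ n => n)).
  - apply (growth_mult 0 0 (fun N n => _ - _) (fun _ _ => / 2)); [|apply growth_const].
    apply growth_minus; [apply (growth_half_harm 0 (fun N n => N - n)%nat)|
      apply (growth_half_harm 0 (fun N n => S (N + n)))].
Qed.

Lemma is_series_of_finite_identities (f : nat -> nat -> R) (g : nat -> R) :
  growth 2 f ->
  (forall n, is_lim_seq (fun N => rho N n) 1) ->
  (forall n, is_lim_seq (fun N => f N n) (g n)) ->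
  (forall N, rsum (fun n => q n * rho N n * f N n) (S N) = 0) ->
  is_series (fun n => q n * g n) 0.
Proof.
  intros (C & HC & Hf) Hrho Hg H0.
  apply tannery_zero with (f := fun N n => q n * rho N n * f N n)
    (B := fun n => 3 * C * Rpower (INR n + 1) (- (5 / 4))).
  - apply ex_series_scal_l with (1 := ex_series_Rpower).
  - intros N n Hn. rewrite Rabs_mult.
    apply Rle_trans with (3 * Rpower (INR n + 1) (- (3 / 2)) * (C * pw n ^ 2)).
    + apply Rmult_le_compat; auto using Rabs_pos, q_rho_le.
    + apply Req_le. unfold pw. simpl pow. rewrite Rmult_1_r, <- Rpower_plus.
      replace (- (5 / 4)) with (- (3 / 2) + (1 / 8 + 1 / 8)) by field.
      rewrite (Rpower_plus (- (3 / 2))). ring.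
  - intros n. apply is_lim_seq_mult'; [|apply Hg].
    replace (q n) with (q n * 1) at 1 by ring.
    apply (is_lim_seq_scal_l _ (q n) 1), Hrho.
  - exact H0.
Qed.

(** * Limits of the coefficients as N grows *)

Lemma is_lim_seq_inv_shift (c : R) : 0 <= c -> is_lim_seq (fun N => / (c + INR N)) 0.
Proof.
  intros Hc. apply (is_lim_seq_inv _ p_infty); [|discriminate].
  apply is_lim_seq_le_p_loc with INR; [|apply is_lim_seq_INR].
  exists O. intros n _. lra.
Qed.

Lemma is_lim_seq_pow0 (u : nat -> R) (k : nat) :
  is_lim_seq u 0 -> is_lim_seq (fun N => u N ^ S k) 0.
Proof.
  intros H. induction k as [|k IH].
  - apply is_lim_seq_ext with u; [intros; simpl; ring|exact H].
  - apply is_lim_seq_ext with (fun N => u N * u N ^ S k); [reflexivity|].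
    replace (Finite 0) with (Finite (0 * 0)) by (f_equal; ring).
    now apply is_lim_seq_mult'.
Qed.

Lemma is_lim_seq_rsum_increment (f : nat -> R) (c : nat) :
  is_lim_seq f 0 -> is_lim_seq (fun N => rsum f (N + c) - rsum f N) 0.
Proof.
  intros H. induction c as [|c IH].
  - apply is_lim_seq_ext with (fun _ => 0); [|apply is_lim_seq_const].
    intros N. rewrite Nat.add_0_r. ring.
  - apply is_lim_seq_ext with (fun N => (rsum f (N + c) - rsum f N) + f (N + c)%nat).
    + intros N. rewrite Nat.add_succ_r. simpl. ring.
    + replace (Finite 0) with (Finite (0 + 0)) by (f_equal; ring).
      apply is_lim_seq_plus'; [exact IH|]. now apply (is_lim_seq_incr_n f c 0).
Qed.

Lemma half_harm_increment (k c : nat) :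
  is_lim_seq (fun N => half_harm (S k) (N + c) - half_harm (S k) N) 0.
Proof.
  apply (is_lim_seq_rsum_increment (fun j => / (/ 2 + INR j) ^ S k)).
  apply is_lim_seq_ext with (fun j => (/ (/ 2 + INR j)) ^ S k).
  - intros j. apply pow_inv.
  - apply is_lim_seq_pow0, is_lim_seq_inv_shift. lra.
Qed.

Lemma harm_rsum (k n : nat) : harm k n = rsum (fun j => / INR (S j) ^ k) n.
Proof.
  unfold harm. induction n as [|n IH].
  - rewrite sum_n_m_zero by lia. reflexivity.
  - rewrite sum_n_Sm by lia. rewrite IH. reflexivity.
Qed.

Lemma harm_increment (k c : nat) :
  is_lim_seq (fun N => harm (S k) (N + c) - harm (S k) N) 0.
Proof.
  apply is_lim_seq_ext with (fun N => rsum (fun j => / INR (S j) ^ S k) (N + c) -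
     rsum (fun j => / INR (S j) ^ S k) N); [intros; now rewrite !harm_rsum|].
  apply is_lim_seq_rsum_increment.
  apply is_lim_seq_ext with (fun j => (/ (1 + INR j)) ^ S k).
  - intros j. rewrite pow_inv. do 2 f_equal. rewrite S_INR. ring.
  - apply is_lim_seq_pow0, is_lim_seq_inv_shift. lra.
Qed.

Lemma tail_harm_harm (k N n : nat) : (n <= N)%nat -> tail_harm k N n = harm k N - harm k n.
Proof.
  intros H. destruct (Nat.le_exists_sub n N H) as [r [-> _]].
  rewrite !harm_rsum. unfold tail_harm. replace (r + n - n)%nat with r by lia.
  rewrite (Nat.add_comm r n), rsum_add. ring.
Qed.

(** Even denominators give the harmonic sum, and odd ones 2j + 1 = 2(j + 1/2) give [half_harm]. This
    identity turns the limits of the [fin_] quantities into the theorem's expressions in H_{2n} and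
    H_n. *)
Lemma harm_double (k n : nat) : 2 ^ k * harm k (2 * n) = half_harm k n + harm k n.
Proof.
  rewrite !harm_rsum. induction n as [|n IH]; [unfold half_harm; simpl; ring|].
  replace (2 * S n)%nat with (S (S (2 * n))) by lia.
  rewrite half_harm_S. cbn [rsum]. rewrite !Rmult_plus_distr_l, IH.
  assert (Hn := pos_INR n).
  replace (2 ^ k * / INR (S (2 * n)) ^ k) with (/ (/ 2 + INR n) ^ k).
  - replace (2 ^ k * / INR (S (S (2 * n))) ^ k) with (/ INR (S n) ^ k); [ring|].
    rewrite <- !pow_inv, <- Rpow_mult_distr. f_equal.
    rewrite !S_INR, mult_INR. simpl. field. lra.
  - rewrite <- !pow_inv, <- Rpow_mult_distr. f_equal.
    rewrite !S_INR, mult_INR. simpl. field. lra.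
Qed.

Lemma harm_lim_zeta (k : nat) : is_lim_seq (harm (S (S k))) (zeta (S (S k))).
Proof.
  assert (H : ex_series (fun j => / INR (S j) ^ S (S k))).
  { apply ex_series_bounded_ge0 with (2 ^ k * 6).
    - intros n. apply Rlt_le, Rinv_0_lt_compat, pow_lt. rewrite S_INR.
      assert (Hn := pos_INR n). lra.
    - intros n. apply Rle_trans with (2 := half_harm_bound k n).
      assert (T := tail_harm_le (S (S k)) n 0). unfold tail_harm in T.
      rewrite Nat.sub_0_r in T. exact T. }
  apply is_lim_seq_incr_1.
  apply is_lim_seq_ext with (sum_n (fun j => / INR (S j) ^ S (S k))).
  - intros n. now rewrite sum_n_rsum, harm_rsum.
  - exact (Series_correct _ H).
Qed.

Lemma tail_harm_lim (k n : nat) :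
  is_lim_seq (fun N => tail_harm (S (S k)) N n) (zeta (S (S k)) - harm (S (S k)) n).
Proof.
  apply is_lim_seq_ext_loc with (fun N => harm (S (S k)) N - harm (S (S k)) n).
  - exists n. intros N HN. now rewrite tail_harm_harm.
  - apply is_lim_seq_minus'; [apply harm_lim_zeta|apply is_lim_seq_const].
Qed.

Lemma harm_between_logs (m k : nat) :
  ln (INR (S m) + INR k + 1) - ln (INR (S m) + 1) <= harm 1 (S m + k) - harm 1 (S m)
    <= ln (INR (S m) + INR k) - ln (INR (S m)).
Proof.
  assert (Hm : 0 < INR (S m)) by (apply lt_0_INR; lia).
  induction k as [|k IH].
  - rewrite Nat.add_0_r. change (INR 0) with 0. rewrite !Rplus_0_r. lra.
  - assert (E : harm 1 (S m + S k) = harm 1 (S m + k) + / (INR (S m) + INR k + 1)).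
    { rewrite !harm_rsum, Nat.add_succ_r. cbn [rsum]. rewrite pow_1, (S_INR (S m + k)), plus_INR.
      reflexivity. }
    assert (Hk := pos_INR k).
    assert (L1 := ln_step (INR (S m) + INR k) ltac:(lra)).
    assert (L2 := ln_step (INR (S m) + INR k + 1) ltac:(lra)).
    rewrite E, (S_INR k).
    replace (INR (S m) + (INR k + 1)) with (INR (S m) + INR k + 1) by ring. lra.
Qed.

Lemma harm_double_lim : is_lim_seq (fun N => harm 1 (2 * N) - harm 1 N) (ln 2).
Proof.
  apply is_lim_seq_incr_1.
  apply is_lim_seq_le_le with (u := fun N => ln 2 - / (1 + INR N)) (w := fun _ => ln 2).
  - intros m. assert (B := harm_between_logs m (S m)).
    replace (S m + S m)%nat with (2 * S m)%nat in B by lia.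
    assert (Hm := pos_INR m). rewrite S_INR in B. rewrite (Rplus_comm 1 (INR m)).
    set (x := INR m + 1) in *. assert (Hx : 0 < x) by (unfold x; lra).
    replace (x + x) with (2 * x) in B by ring. rewrite (ln_mult 2 x) in B by lra.
    assert (H1 : ln (2 * x) <= ln (2 * x + 1)) by (apply ln_le; lra).
    rewrite (ln_mult 2 x) in H1 by lra. assert (L := ln_step x Hx). lra.
  - replace (Finite (ln 2)) with (Finite (ln 2 - 0)) by (f_equal; ring).
    apply is_lim_seq_minus'; [apply is_lim_seq_const|apply is_lim_seq_inv_shift; lra].
  - apply is_lim_seq_const.
Qed.

Lemma fin_A_lim (n : nat) : is_lim_seq (fun N => fin_A N n) (A n).
Proof.
  apply (is_lim_seq_incr_n _ n).
  (* The index is shifted by n to remove the truncated subtraction, and [half_harm 1 N] is rewritten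
     as 2 H_{2N} - H_N. The divergent parts then combine into -2 (H_{2N} - H_N), the source of -2
     log 2. *)
  apply is_lim_seq_ext with (fun N => / (4 * INR n + 1) + 2 * half_harm 1 n - harm 1 n
    + ((harm 1 (N + n) - harm 1 N) - 2 * (harm 1 (2 * N) - harm 1 N)
       - / 2 * (half_harm 1 (N + S (n + n)) - half_harm 1 N))).
  - intros N. unfold fin_A. rewrite tail_harm_harm by lia.
    replace (N + n - n)%nat with N by lia.
    replace (S (N + n + n)) with (N + S (n + n))%nat by lia.
    assert (E := harm_double 1 N). rewrite pow_1 in E. lra.
  - replace (A n) with (/ (4 * INR n + 1) + 2 * half_harm 1 n - harm 1 n
       + (0 - 2 * ln 2 - / 2 * 0)).
    + apply is_lim_seq_plus'; [apply is_lim_seq_const|].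
      apply is_lim_seq_minus'.
      * apply is_lim_seq_minus'; [apply harm_increment|].
        apply (is_lim_seq_scal_l _ 2 (ln 2)), harm_double_lim.
      * apply (is_lim_seq_scal_l _ (/ 2) 0), half_harm_increment.
    + unfold A. assert (E := harm_double 1 n). rewrite pow_1 in E. lra.
Qed.

Lemma fin_R_lim (n : nat) : is_lim_seq (fun N => fin_R N n) (Defs.Rn n).
Proof.
  apply (is_lim_seq_incr_n _ n).
  apply is_lim_seq_ext with (fun N => 2 / (4 * INR n + 1) ^ 2 + half_harm 2 n
    - / 2 * (half_harm 2 (N + S (n + n)) - half_harm 2 N)).
  - intros N. unfold fin_R. replace (N + n - n)%nat with N by lia.
    replace (S (N + n + n)) with (N + S (n + n))%nat by lia. field.
    assert (Hn := pos_INR n). lra.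
  - replace (Defs.Rn n) with (2 / (4 * INR n + 1) ^ 2 + half_harm 2 n - / 2 * 0).
    + apply is_lim_seq_minus'; [apply is_lim_seq_const|].
      apply (is_lim_seq_scal_l _ (/ 2) 0), half_harm_increment.
    + unfold Defs.Rn. assert (E := harm_double 2 n). lra.
Qed.

Lemma fin_X_lim (n : nat) : is_lim_seq (fun N => fin_X N n) (X n).
Proof.
  unfold fin_X, X. simpl pow. apply is_lim_seq_minus'.
  - apply is_lim_seq_mult'; [apply fin_A_lim|].
    apply is_lim_seq_mult'; [apply fin_A_lim|apply is_lim_seq_const].
  - apply (is_lim_seq_scal_l _ (1 / 2) (Defs.Rn n)), fin_R_lim.
Qed.

Lemma fin_U3_lim (n : nat) : is_lim_seq (fun N => fin_U3 N n) (U3 n).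
Proof.
  replace (U3 n) with (half_harm 3 n - (zeta 3 - harm 3 n)).
  - apply is_lim_seq_minus'; [apply is_lim_seq_const|apply tail_harm_lim].
  - unfold U3. assert (E := harm_double 3 n). lra.
Qed.

Lemma fin_U4_lim (n : nat) : is_lim_seq (fun N => fin_U4 N n) (U4 n).
Proof.
  replace (U4 n) with (half_harm 4 n + (zeta 4 - harm 4 n)).
  - apply is_lim_seq_plus'; [apply is_lim_seq_const|apply tail_harm_lim].
  - unfold U4. assert (E := harm_double 4 n). lra.
Qed.

Lemma fin_U5_lim (n : nat) : is_lim_seq (fun N => fin_U5 N n) (U5 n).
Proof.
  replace (U5 n) with (half_harm 5 n + (zeta 5 - harm 5 n)).
  - apply is_lim_seq_plus'; [apply is_lim_seq_const|apply tail_harm_lim].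
  - unfold U5. assert (E := harm_double 5 n). lra.
Qed.

Lemma fin_U7_lim (n : nat) : is_lim_seq (fun N => fin_U7 N n) (U7 n).
Proof.
  replace (U7 n) with (half_harm 7 n - (zeta 7 - harm 7 n)).
  - apply is_lim_seq_minus'; [apply is_lim_seq_const|apply tail_harm_lim].
  - unfold U7. assert (E := harm_double 7 n). lra.
Qed.

Lemma central_ratio_lim (c : nat) : is_lim_seq (fun N => central N / central (N + c)) 1.
Proof.
  induction c as [|c IH].
  - apply is_lim_seq_ext with (fun _ => 1); [|apply is_lim_seq_const].
    intros N. rewrite Nat.add_0_r. field. apply Rgt_not_eq, central_pos.
  - apply is_lim_seq_ext with
      (fun N => central N / central (N + c) * (1 + / 2 * / (/ 2 + INR (N + c)))).
    + intros N. rewrite Nat.add_succ_r, central_S, S_INR.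
      assert (H := central_pos (N + c)). assert (H1 := pos_INR (N + c)). field. lra.
    + replace (Finite 1) with (Finite (1 * (1 + / 2 * 0))) by (f_equal; ring).
      apply is_lim_seq_mult'; [exact IH|].
      apply is_lim_seq_plus'; [apply is_lim_seq_const|].
      apply (is_lim_seq_scal_l _ (/ 2) 0).
      apply (is_lim_seq_incr_n (fun N => / (/ 2 + INR N)) c 0), is_lim_seq_inv_shift. lra.
Qed.

Lemma rho_lim (n : nat) : is_lim_seq (fun N => rho N n) 1.
Proof.
  apply (is_lim_seq_incr_n _ n).
  apply is_lim_seq_ext with (fun N => (1 - INR n * / (/ 2 + 2 * INR n + INR N)) *
    (central N / central (N + (n + n)))).
  - intros N. unfold rho. replace (N + n - n)%nat with N by lia.
    replace (N + n + n)%nat with (N + (n + n))%nat by lia. rewrite plus_INR.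
    assert (H := central_pos (N + (n + n))). assert (H1 := pos_INR n). assert (H2 := pos_INR N).
    field. lra.
  - replace (Finite 1) with (Finite ((1 - INR n * 0) * 1)) by (f_equal; ring).
    apply is_lim_seq_mult'; [|apply central_ratio_lim].
    apply is_lim_seq_minus'; [apply is_lim_seq_const|].
    apply (is_lim_seq_scal_l _ (INR n) 0), is_lim_seq_inv_shift.
    assert (H := pos_INR n). lra.
Qed.

(** * Domination and convergence for the four series *)

Lemma growth_fin_U3 : growth 0 fin_U3.
Proof.
  apply growth_minus; [apply (growth_half_harm 1 (fun _ n => n))|apply (growth_tail_harm 1)].
Qed.

Lemma growth_fin_U4 : growth 0 fin_U4.
Proof.
  apply growth_plus; [apply (growth_half_harm 2 (fun _ n => n))|apply (growth_tail_harm 2)].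
Qed.

Lemma growth_fin_U5 : growth 0 fin_U5.
Proof.
  apply growth_plus; [apply (growth_half_harm 3 (fun _ n => n))|apply (growth_tail_harm 3)].
Qed.

Lemma growth_fin_U7 : growth 0 fin_U7.
Proof.
  apply growth_minus; [apply (growth_half_harm 5 (fun _ n => n))|apply (growth_tail_harm 5)].
Qed.

Lemma growth_fin_X : growth 2 fin_X.
Proof.
  unfold fin_X. simpl pow. apply growth_minus.
  - apply (growth_mult 1 1); [exact growth_fin_A|].
    apply (growth_mult 1 0); [exact growth_fin_A|apply growth_const].
  - apply growth_scal, growth_weaken with (2 := growth_fin_R). lia.
Qed.

Theorem proposition6p1 :
  is_series (fun n : nat => q n * U3 n) 0 /\
  is_series (fun n : nat => q n * (A n * U4 n - U5 n)) 0 /\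
  is_series (fun n : nat => q n * (X n * U4 n - 2 * A n * U5 n + U3 n ^ 2)) 0 /\
  is_series (fun n : nat => q n * (U3 n * U4 n - U7 n)) 0.
Proof.
  assert (W : forall f, growth 0 f -> growth 2 f) by (intros f; apply growth_weaken; lia).
  assert (W1 : forall f, growth 1 f -> growth 2 f) by (intros f; apply growth_weaken; lia).
  repeat split.
  - apply is_series_of_finite_identities with fin_U3;
      [apply W, growth_fin_U3|exact rho_lim|exact fin_U3_lim|].
    intros N. apply finite_identities_e34.
  - apply is_series_of_finite_identities with (fun N n => fin_A N n * fin_U4 N n - fin_U5 N n).
    + apply growth_minus; [|apply W, growth_fin_U5].
      apply W1, (growth_mult 1 0); [exact growth_fin_A|exact growth_fin_U4].
    + exact rho_lim.
    + intros n. apply is_lim_seq_minus'; [|apply fin_U5_lim].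
      apply is_lim_seq_mult'; [apply fin_A_lim|apply fin_U4_lim].
    + exact finite_identity_e14.
  - apply is_series_of_finite_identities with
      (fun N n => fin_X N n * fin_U4 N n - 2 * fin_A N n * fin_U5 N n + fin_U3 N n ^ 2).
    + apply growth_plus; [apply growth_minus|].
      * apply (growth_mult 2 0); [exact growth_fin_X|exact growth_fin_U4].
      * apply W1, (growth_mult 1 0); [apply growth_scal, growth_fin_A|exact growth_fin_U5].
      * apply W. simpl pow. apply (growth_mult 0 0); [exact growth_fin_U3|].
        apply (growth_mult 0 0); [exact growth_fin_U3|apply growth_const].
    + exact rho_lim.
    + intros n. simpl pow. apply is_lim_seq_plus'; [apply is_lim_seq_minus'|].
      * apply is_lim_seq_mult'; [apply fin_X_lim|apply fin_U4_lim].
      * apply is_lim_seq_mult'; [|apply fin_U5_lim].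
        apply (is_lim_seq_scal_l _ 2 (A n)), fin_A_lim.
      * apply is_lim_seq_mult'; [apply fin_U3_lim|].
        apply is_lim_seq_mult'; [apply fin_U3_lim|apply is_lim_seq_const].
    + exact finite_identity_p2_slice.
  - apply is_series_of_finite_identities with (fun N n => fin_U3 N n * fin_U4 N n - fin_U7 N n).
    + apply growth_minus; [|apply W, growth_fin_U7].
      apply W, (growth_mult 0 0); [exact growth_fin_U3|exact growth_fin_U4].
    + exact rho_lim.
    + intros n. apply is_lim_seq_minus'; [|apply fin_U7_lim].
      apply is_lim_seq_mult'; [apply fin_U3_lim|apply fin_U4_lim].
    + intros N. apply finite_identities_e34.
Qed.
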